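(* Let $k>1$ and consider the finite-horizon MDP with the Cressie–Read distributionally robust risk $\mathcal R^\pi$ (divergence function $\phi(x)=\frac{x^k-kx+k-1}{k(k-1)}$) and the empirical risks described in the context. (i) Let $\pi$ be a randomized Markovian policy of the augmented MDP with $\|\pi_t(\cdot|s,x)-\pi_t(\cdot|s,x')\|_1\le L_\pi|x-x'|$ for all $0\le t\le T$, $s\in\mathcal S_t$, $x,x'\in\mathcal X_t$, for some $L_\pi>0$. For any $\epsilon>0$ and $\delta\in(0,1)$, take $$n=\mathcal O\left(\frac{T^2\,(k^2T\tau/\epsilon+k)^{2/(k-1)}}{\epsilon^2}\log\left(\frac{T|\mathcal S|L_\pi\,\tau\,(k^2T\tau/\epsilon+k)^{1/(k-1)}}{\delta\epsilon}\right)\right).$$ Then with probability at least $1-\delta$, $|\hat{\mathcal R}^\pi_n(s)-\mathcal R^\pi(s)|\le\epsilon$ for all $s\in\mathcal S_0$. (ii) In addition, for any $\epsilon>0$ and $\delta\in(0,1)$, take $$n=\mathcal O\left(\frac{T^3\,(k^2T\tau/\epsilon+k)^{2/(k-1)}}{\epsilon^2}\log\left(\frac{T|\mathcal S||\mathcal A|\,\tau\,(k^2T\tau/\epsilon+k)^{1/(k-1)}}{\delta\epsilon}\right)\right).$$ Then with probability at least $1-\delta$, $|\hat{\mathcal R}^*_n(s)-\mathcal R^*(s)|\le\epsilon$ for all $s\in\mathcal S_0$.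
   Context: MDP: $T$ is a positive integer; for $0\le t\le T$, $\mathcal S_t$ is a finite state space, $\mathcal A_t$ a finite action space, $c_t:\mathcal S_t\times\mathcal A_t\to[0,1]$ a cost; for $0\le t\le T-1$, $\mathbb P_t(\cdot|s,a)$ is a probability distribution on $\mathcal S_{t+1}$, and $S_{t+1}\sim\mathbb P_t(\cdot|S_t,A_t)$. $|\mathcal S|=\max_t|\mathcal S_t|$, $|\mathcal A|=\max_t|\mathcal A_t|$. $\Pi(\mathcal M)$ is the set of randomized history-dependent policies (mapping $H_t=(S_0,A_0,\dots,S_t)$ to distributions on $\mathcal A_t$, from which $A_t$ is drawn). Augmented state: $\mathcal X_t=[0,t]$, $X_0=0$, $X_{t+1}=X_t+c_t(S_t,A_t)$; a randomized Markovian policy of the augmented MDP takes $A_t\sim\pi_t(\cdot|S_t,X_t)$. Risk: $\tau>0$ is the ambiguity radius; $\phi(x)=\frac{x^k-kx+k-1}{k(k-1)}$ for $x\ge0$ and $\phi(x)=+\infty$ for $x<0$. With $Z=\sum_{t=0}^Tc_t(S_t,A_t)$, $$\mathcal R^\pi(s)=\min_{\lambda\ge0,\ \mu\in\mathbb R}\Big\{\lambda\tau+\mu+\mathbb E^\pi_{\mathbb P}\big[(\lambda\phi)^*(Z-\mu)\mid S_0=s\big]\Big\},$$ where $(\lambda\phi)^*(y)=\sup_x\{xy-\lambda\phi(x)\}$ is the convex conjugate (with $0\cdot(+\infty)=+\infty$). $\mathcal R^*(s)=\min_{\pi\in\Pi(\mathcal M)}\mathcal R^\pi(s)$. Sampling: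 for every $t$ and $(s,a)$ one draws $n$ i.i.d. samples from $\mathbb P_t(\cdot|s,a)$ (independently over $(t,s,a)$), giving empirical kernels $\hat{\mathbb P}_{t,n}$. $\hat{\mathcal R}^\pi_n$ is $\mathcal R^\pi$ with $\mathbb P_t$ replaced by $\hat{\mathbb P}_{t,n}$; $\hat{\mathcal R}^*_n(s)=\min_{\pi\in\Pi(\mathcal M)}\hat{\mathcal R}^\pi_n(s)$. In (i), $\pi$ is a given policy, not depending on the samples.
   Formalization: The logarithm in each sample size is replaced by its maximum with 1, and inside it L_π τ is replaced by max(1, L_π τ) in (i) and τ by max(1, τ) in (ii), since for tiny L_π τ or τ the printed bounds can vanish or lose their dependence on δ. *)

(* Defs.v *)
From HB Require Import structures.
From mathcomp Require Import all_boot all_order all_algebra.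
From mathcomp Require Import all_classical all_reals all_analysis.

Set Implicit Arguments.
Unset Strict Implicit.
Unset Printing Implicit Defensive.

Import Order.TTheory GRing.Theory Num.Theory.

Local Open Scope classical_set_scope.
Local Open Scope ring_scope.

Definition is_distr (R : realType) (X : finType) (p : X -> R) : Prop :=
  (forall x, 0 <= p x) /\ \sum_(x : X) p x = 1.

(* Stages are natural numbers; only the data at stages t <= T (t < T for the
   transition kernels) are constrained, and only those are used below. *)
Record mdp (R : realType) (T : nat) := Mdp {
  state : nat -> finType;
  action : nat -> finType;
  cost : forall t, state t -> action t -> R;
  trans : forall t, state t -> action t -> state t.+1 -> R;
  action_gt0 : forall t, (t <= T)%N -> (0 < #|action t|)%N;
  cost_itv : forall t (s : state t) (a : action t),
    (t <= T)%N -> 0 <= cost s a <= 1;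
  trans_distr : forall t (s : state t) (a : action t),
    (t < T)%N -> is_distr (trans s a) }.

Section MDP.
Variables (R : realType) (T : nat) (M : mdp R T).

Definition trans_kernel : Type := forall t, state M t -> action M t -> state M t.+1 -> R.

Definition max_states : nat := \max_(t < T.+1) #|state M t|.
Definition max_actions : nat := \max_(t < T.+1) #|action M t|.

(* H_t = (S_0, A_0, ..., A_{t-1}, S_t), nested to the left. *)
Fixpoint hist (t : nat) : finType :=
  match t with
  | 0 => state M 0
  | t'.+1 => (hist t' * action M t' * state M t'.+1)%type
  end.

Definition cur (t : nat) : hist t -> state M t :=
  match t return hist t -> state M t with
  | 0 => fun h => h
  | t'.+1 => fun h : hist t' * action M t' * state M t'.+1 => h.2
  end.

(* The augmented state X_t. *)
Fixpoint cum_cost (t : nat) : hist t -> R :=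
  match t return hist t -> R with
  | 0 => fun=> 0
  | t'.+1 => fun h : hist t' * action M t' * state M t'.+1 =>
      cum_cost h.1.1 + cost (cur h.1.1) h.1.2
  end.

Definition policy : Type := forall t, hist t -> action M t -> R.

Definition is_policy (pi : policy) : Prop :=
  forall t (h : hist t), (t <= T)%N -> is_distr (pi t h).

Definition aug_policy : Type := forall t, state M t -> R -> action M t -> R.

Definition is_aug_policy (pi : aug_policy) : Prop :=
  forall t (s : state M t) (x : R), (t <= T)%N -> 0 <= x <= t%:R ->
    is_distr (pi t s x).

Definition lipschitz_aug_policy (L : R) (pi : aug_policy) : Prop :=
  forall t (s : state M t) (x x' : R), (t <= T)%N ->
    0 <= x <= t%:R -> 0 <= x' <= t%:R ->
    \sum_(a : action M t) `|pi t s x a - pi t s x' a| <= L * `|x - x'|.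

Definition policy_of_aug (pi : aug_policy) : policy :=
  fun t h => pi t (cur h) (cum_cost h).

(* Probability of the history h under kernel Q and policy pi, given S_0 = s. *)
Fixpoint hist_prob (Q : trans_kernel) (pi : policy) (s : state M 0) (t : nat) :
    hist t -> R :=
  match t return hist t -> R with
  | 0 => fun h : state M 0 => (h == s)%:R
  | t'.+1 => fun h : hist t' * action M t' * state M t'.+1 =>
      hist_prob Q pi s h.1.1 * pi t' h.1.1 h.1.2 * Q t' (cur h.1.1) h.1.2 h.2
  end.

(* E^pi_Q[g(Z) | S_0 = s], with Z = c_0(S_0, A_0) + ... + c_T(S_T, A_T).
   Outcomes of probability 0 contribute 0, even where g is infinite. *)
Definition expect_total_cost (Q : trans_kernel) (pi : policy) (s : state M 0)
    (g : R -> \bar R) : \bar R :=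
  (\sum_(w : hist T * action M T)
     (hist_prob Q pi s w.1 * pi T w.1 w.2)%R%:E
       * g (cum_cost w.1 + cost (cur w.1) w.2)%R)%E.

End MDP.

Definition cressie_read (R : realType) (k x : R) : \bar R :=
  if 0 <= x then ((x `^ k - k * x + k - 1) / (k * (k - 1)))%:E else +oo%E.

(* Multiplication by a nonnegative real, with the convention 0 * +oo = +oo. *)
Definition scale_fun (R : realType) (l : R) (f : R -> \bar R) (x : R) : \bar R :=
  if f x == +oo%E then +oo%E else (l%:E * f x)%E.

Definition conjugate (R : realType) (f : R -> \bar R) (y : R) : \bar R :=
  ereal_sup [set ((x * y)%R%:E - f x)%E | x in [set: R]].

(* R^pi(s), with the transition kernel as a parameter. *)
Definition dr_risk (R : realType) (T : nat) (M : mdp R T) (k tau : R)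
    (Q : trans_kernel M) (pi : policy M) (s : state M 0) : \bar R :=
  ereal_inf
    [set ((lm.1 * tau + lm.2)%R%:E
          + expect_total_cost Q pi s (fun z =>
              conjugate (scale_fun lm.1 (cressie_read k)) (z - lm.2)%R))%E
    | lm in [set lm : R * R | 0 <= lm.1]].

Definition opt_dr_risk (R : realType) (T : nat) (M : mdp R T) (k tau : R)
    (Q : trans_kernel M) (s : state M 0) : \bar R :=
  ereal_inf [set dr_risk k tau Q pi s | pi in [set pi | is_policy pi]].

(* An outcome of the sampling: om t (s, a, i) is the i-th of the n draws from
   the transition law at (t, s, a). *)
Definition sample (R : realType) (T : nat) (M : mdp R T) (n : nat) : finType :=
  {dffun forall t : 'I_T, {ffun state M t * action M t * 'I_n -> state M t.+1}}.

(* Joint law of independent draws: the product of the transition laws. *)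
Definition sample_prob (R : realType) (T : nat) (M : mdp R T) (n : nat)
    (E : pred (sample M n)) : R :=
  \sum_(om : sample M n | E om)
    \prod_(t < T) \prod_(x : state M t * action M t * 'I_n)
      trans x.1.1 x.1.2 (om t x).

(* The empirical frequencies; the value at stages t >= T is never used. *)
Definition empirical (R : realType) (T : nat) (M : mdp R T) (n : nat)
    (om : sample M n) : trans_kernel M :=
  fun t s a s' =>
    match decP (@idP (t < T)%N) with
    | left ltT => #|[pred i : 'I_n | om (Ordinal ltT) (s, a, i) == s']|%:R / n%:R
    | right _ => 0
    end.

(* Main.v *)
Require Import Defs.
From mathcomp Require Import all_boot all_order all_algebra.
From mathcomp Require Import all_classical all_reals all_analysis.
From mathcomp Require Import ring lra.

Set Implicit Arguments.
Unset Strict Implicit.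
Unset Printing Implicit Defensive.

Import Order.TTheory GRing.Theory Num.Theory.

Local Open Scope ring_scope.

(* The objective [l * tau + m + (l phi)^*(z - m)] grows by at most [tau] times
   the increment when [l] increases and by at most the increment when [m]
   increases, and [m] may be clamped to [0, T + 1]; hence a grid of O(T / eps)
   values of [l >= eps / (8 tau)] and of [m] is enough up to [eps / 4].  On this
   grid the objective is Lipschitz in [z] with a constant of order
   [(k^2 T tau / eps + k)^(1/(k-1))], so it has range [B = O(T) * that constant].

   For a fixed policy, the empirical expectation is an average over index
   choices [c : 'I_T -> 'I_n] of the mean of [n] independent copies, copy [j]
   using the draw [c t + j] at stage [t] (Hoeffding's decoupling of
   U-statistics).  Jensen's inequality and [exp (x - x^2) <= 1 + x] give a
   sub-Gaussian tail of variance proxy [B^2 / n], without any loss in [T].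

   For the optimum, let [V] be the value function of the true model and
   [u = 1 - r V].  Along any fixed history the empirical means of [ln u] exceed
   [ln] of the true means of [u] by an amount whose exponential (scaled by [n])
   has expectation 1.  A union bound over the (|S| |A|)^T |S| histories costs
   [T log (|S| |A|)], and telescoping [ln u] along the empirical chain shows that
   no policy beats the true optimum by more than [r B^2 + T log(..) / (n r)]. *)

(** * The sampling law *)

(** Distributivity for dependent functions, needed because the state space changes with the stage.
    The family is recoded through [fprod] as sums over tagged elements, where the non-dependent law
    applies. *)
Lemma sum_dffun_prod (R : comNzSemiRingType) (I : finType) (T_ : I -> finType)
    (f : forall i, T_ i -> R) :
  \sum_(g : {dffun forall i : I, T_ i}) \prod_i f i (g i) = \prod_i \sum_x f i x.
Proof.
rewrite (reindex (@dffun_of_fprod I T_)); last exact/onW_bij/dffun_of_fprod_bij.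
pose F i := [ffun x => f i x].
transitivity (\sum_(g : fprod T_) \prod_i F i (g i)).
  by apply: eq_bigr => g _; apply: eq_bigr => i _; rewrite !ffunE.
rewrite (big_fprod_dep _ _ F predT) big_mkcondr /=.
transitivity (\prod_i \sum_(j in tagged_with T_ i) untag 0 (F i) j).
  by rewrite bigA_distr_big_dep.
apply: eq_bigr => i _; rewrite -(big_tag (fun i => F i)).
by apply: eq_bigr => x _; rewrite ffunE.
Qed.

Section Sample.
Variables (R : realType) (T : nat) (M : mdp R T) (n : nat).

Definition Esample (X : sample M n -> R) : R :=
  \sum_(om : sample M n)
    (\prod_(t < T) \prod_(x : state M t * action M t * 'I_n)
        trans x.1.1 x.1.2 (om t x)) * X om.

Lemma weight_ge0 (om : sample M n) :
  0 <= \prod_(t < T) \prod_(x : state M t * action M t * 'I_n)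
        trans x.1.1 x.1.2 (om t x).
Proof.
apply: prodr_ge0 => t _; apply: prodr_ge0 => x _.
by have [] := trans_distr x.1.1 x.1.2 (ltn_ord t).
Qed.

Lemma le_Esample (X Y : sample M n -> R) :
  (forall om, X om <= Y om) -> Esample X <= Esample Y.
Proof.
by move=> XY; apply: ler_sum => om _; rewrite ler_wpM2l ?weight_ge0.
Qed.

Lemma EsampleZ (c : R) (X : sample M n -> R) :
  Esample (fun om => c * X om) = c * Esample X.
Proof. by rewrite /Esample mulr_sumr; apply: eq_bigr => om _; rewrite mulrCA. Qed.

Lemma Esample_sum (I : finType) (X : I -> sample M n -> R) :
  Esample (fun om => \sum_i X i om) = \sum_i Esample (X i).
Proof.
by rewrite /Esample exchange_big; apply: eq_bigr => om _; rewrite mulr_sumr.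
Qed.

(** Independence: at stage [t] the [i]-th draw is read at the single pair [b t i], so the factors
    involve distinct coordinates of [om], and the coordinates that are not read integrate to 1. *)
Lemma Esample_prod (b : forall t : 'I_T, 'I_n -> state M t * action M t)
    (f : forall t : 'I_T, 'I_n -> state M t.+1 -> R) :
  Esample (fun om => \prod_(t < T) \prod_(i < n) f t i (om t (b t i, i))) =
  \prod_(t < T) \prod_(i < n) \sum_s' trans (b t i).1 (b t i).2 s' * f t i s'.
Proof.
(* Writing the factor as 1 off the pairs being read turns the product into one over all
   coordinates. *)
pose g (t : 'I_T) (x : state M t * action M t * 'I_n) s' :=
  trans x.1.1 x.1.2 s' * (if x.1 == b t x.2 then f t x.2 s' else 1).
transitivity (\sum_(om : sample M n) \prod_t \prod_x g t x (om t x)).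
  apply: eq_bigr => om _; rewrite -big_split; apply: eq_bigr => t _ /=.
  rewrite big_split /=; congr (_ * _); rewrite -big_mkcond /=.
  rewrite (reindex_onto (fun i => (b t i, i)) snd) /=.
    by apply: eq_bigl => i; rewrite !eqxx.
  by case=> y i /= /eqP ->.
rewrite (sum_dffun_prod (fun (t : 'I_T)
  (h : {ffun state M t * action M t * 'I_n -> state M t.+1}) =>
  \prod_x g t x (h x))).
apply: eq_bigr => t _; rewrite -(bigA_distr_bigA (g t)).
rewrite [LHS](bigID [pred x | x.1 == b t x.2]) /= [X in _ * X]big1 ?mulr1.
  rewrite (reindex_onto (fun i => (b t i, i)) snd) /=.
    by apply: eq_big => [i|i _]; rewrite ?eqxx // /g eqxx.
  by case=> y i /= /eqP ->.
move=> x /negbTE xb; rewrite /g xb.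
under eq_bigr do rewrite mulr1.
by have [] := trans_distr x.1.1 x.1.2 (ltn_ord t).
Qed.

Lemma Esample_cst (c : R) : Esample (fun=> c) = c.
Proof.
rewrite -[c in LHS]mulr1 (EsampleZ c (fun=> 1)) -[RHS]mulr1; congr (_ * _).
rewrite /Esample; under eq_bigr do rewrite mulr1.
rewrite (sum_dffun_prod (fun (t : 'I_T)
  (h : {ffun state M t * action M t * 'I_n -> state M t.+1}) =>
  \prod_x trans x.1.1 x.1.2 (h x))).
rewrite big1 // => t _.
rewrite -(bigA_distr_bigA (fun x : state M t * action M t * 'I_n =>
  trans x.1.1 x.1.2)) big1 // => x _.
by have [] := trans_distr x.1.1 x.1.2 (ltn_ord t).
Qed.

Lemma sample_probE (E : pred (sample M n)) :
  sample_prob E = Esample (fun om => (E om)%:R).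
Proof.
rewrite /sample_prob big_mkcond; apply: eq_bigr => om _.
by case: (E om); rewrite ?mulr1 ?mulr0.
Qed.

Lemma sample_prob_ge (E F : pred (sample M n)) (c : R) :
  sample_prob F <= c -> (forall om, ~~ F om -> E om) -> 1 - c <= sample_prob E.
Proof.
rewrite !sample_probE => Fc FE; rewrite lerBlDr.
rewrite -[X in X <= _](Esample_cst 1).
apply: (le_trans _ (lerD (lexx _) Fc)); rewrite /Esample -big_split /=.
apply: ler_sum => om _; rewrite -mulrDr ler_wpM2l ?weight_ge0 //.
case: (boolP (F om)) => [_|/FE ->]; first by rewrite lerDr.
by rewrite addr0.
Qed.

(** Markov's inequality at level 1; exponential moments are rescaled to this level before use. *)
Lemma sample_prob_le (E : pred (sample M n)) (X : sample M n -> R) :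
  (forall om, 0 <= X om) -> (forall om, E om -> 1 <= X om) ->
  sample_prob E <= Esample X.
Proof.
move=> X0 X1; rewrite sample_probE; apply: le_Esample => om.
by case: (boolP (E om)) => [/X1|_].
Qed.

Lemma sample_prob_mono (E F : pred (sample M n)) :
  (forall om, E om -> F om) -> sample_prob E <= sample_prob F.
Proof.
move=> EF; rewrite [sample_prob F]sample_probE; apply: sample_prob_le => om.
  by rewrite ler0n.
by move/EF=> ->.
Qed.

Lemma sample_prob_exists (I : finType) (E : I -> pred (sample M n)) :
  sample_prob (fun om => [exists i, E i om]) <= \sum_i sample_prob (E i).
Proof.
under eq_bigr do rewrite sample_probE.
rewrite -Esample_sum; apply: sample_prob_le => om.
  by apply: sumr_ge0 => i _; rewrite ler0n.
move=> /existsP[i Ei]; rewrite (bigD1 i) //= Ei lerDl.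
by apply: sumr_ge0 => j _; rewrite ler0n.
Qed.

Lemma sample_probU (E F : pred (sample M n)) :
  sample_prob (fun om => E om || F om) <= sample_prob E + sample_prob F.
Proof.
rewrite [sample_prob E]sample_probE [sample_prob F]sample_probE.
rewrite /Esample -big_split /=; under eq_bigr do rewrite -mulrDr.
apply: (@sample_prob_le _ (fun om => (E om)%:R + (F om)%:R)) => om.
  by rewrite addr_ge0 ?ler0n.
by case: (E om) (F om) => [] [] //= _; lra.
Qed.

End Sample.

(** * Histories and expectations *)

Section Histories.
Variables (R : realType) (T : nat) (M : mdp R T).
Implicit Types (Q : trans_kernel M) (pi : policy M) (s : state M 0).

Definition is_kernel Q : Prop :=
  forall t (s : state M t) (a : action M t), (t < T)%N -> is_distr (Q t s a).

Definition hist_exp Q pi s t (f : hist M t -> R) : R :=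
  \sum_h hist_prob Q pi s h * f h.

Definition expect Q pi s (g : hist M T * action M T -> R) : R :=
\sum_w hist_prob Q pi s w.1 * pi T w.1 w.2 * g w.

(** Conditioning on the history before the last transition; every induction on the stage below rests
    on this step. *)
Lemma hist_expS Q pi s t (f : hist M t.+1 -> R) :
  hist_exp Q pi s f = hist_exp Q pi s (fun h =>
    \sum_a pi t h a * \sum_s' Q t (cur h) a s' * f (h, a, s')).
Proof.
rewrite /hist_exp; under [RHS]eq_bigr do rewrite mulr_sumr.
rewrite pair_bigA /=; under [RHS]eq_bigr do rewrite !mulr_sumr.
rewrite pair_bigA /=; apply: eq_bigr => -[[h a] s'] _ /=.
by rewrite !mulrA.
Qed.

Lemma expectE Q pi s g :
  expect Q pi s g = hist_exp Q pi s (fun h => \sum_a pi T h a * g (h, a)).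
Proof.
rewrite /expect /hist_exp; under [RHS]eq_bigr do rewrite mulr_sumr.
by rewrite pair_bigA /=; apply: eq_bigr => -[h a] _ /=; rewrite mulrA.
Qed.

Lemma expect_affine Q pi s c r g :
  expect Q pi s (fun w => c + r * g w) =
  expect Q pi s (fun=> c) + r * expect Q pi s g.
Proof.
rewrite /expect mulr_sumr -big_split /=; apply: eq_bigr => w _.
by rewrite mulrDr; congr (_ + _); rewrite mulrCA.
Qed.

Lemma hist_exp_affine Q pi s t c r (f : hist M t -> R) :
  hist_exp Q pi s (fun h => c + r * f h) =
  hist_exp Q pi s (fun=> c : R) (t := t) + r * hist_exp Q pi s f.
Proof.
rewrite /hist_exp mulr_sumr -big_split /=; apply: eq_bigr => w _.
by rewrite mulrDr; congr (_ + _); rewrite mulrCA.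
Qed.

Section Distributions.
Variables (Q : trans_kernel M) (pi : policy M) (s : state M 0).
Hypotheses (kQ : is_kernel Q) (ppi : is_policy pi).

Lemma hist_prob_ge0 t (h : hist M t) : (t <= T)%N -> 0 <= hist_prob Q pi s h.
Proof.
elim: t h => [|t IH] /=; first by move=> h _; rewrite ler0n.
case=> [[h a] s'] ltT /=; rewrite !mulr_ge0 ?IH ?(ltnW ltT) //.
  by have [] := ppi h (ltnW ltT).
by have [] := kQ (cur h) a ltT.
Qed.

Lemma le_hist_exp t (f g : hist M t -> R) : (t <= T)%N ->
  (forall h, f h <= g h) -> hist_exp Q pi s f <= hist_exp Q pi s g.
Proof.
by move=> tT fg; apply: ler_sum => h _; rewrite ler_wpM2l ?hist_prob_ge0.
Qed.

Lemma hist_exp_cst t c : (t <= T)%N -> hist_exp Q pi s (fun=> c) (t := t) = c.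
Proof.
elim: t => [|t IH] tT.
  rewrite /hist_exp (bigD1 s) //= eqxx mul1r big1 ?addr0 // => h /negbTE ->.
  by rewrite mul0r.
rewrite hist_expS -[RHS]IH ?(ltnW tT) //; apply: eq_bigr => h _; congr (_ * _).
transitivity (\sum_a pi h a * c); last first.
  by rewrite -mulr_suml; have [_ ->] := ppi h (ltnW tT); rewrite mul1r.
apply: eq_bigr => a _; rewrite -mulr_suml.
by have [_ ->] := kQ (cur h) a tT; rewrite mul1r.
Qed.

Lemma path_prob_ge0 (w : hist M T * action M T) :
  0 <= hist_prob Q pi s w.1 * pi w.1 w.2.
Proof.
by rewrite mulr_ge0 ?hist_prob_ge0 //; have [] := ppi w.1 (leqnn T).
Qed.

Lemma le_expect g g' : (forall w, g w <= g' w) ->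
  expect Q pi s g <= expect Q pi s g'.
Proof.
by move=> gg; apply: ler_sum => w _; rewrite ler_wpM2l ?path_prob_ge0.
Qed.

Lemma expect_cst c : expect Q pi s (fun=> c) = c.
Proof.
rewrite expectE -[RHS](@hist_exp_cst T c) //; apply: eq_bigr => h _.
by rewrite -mulr_suml; have [_ ->] := ppi h (leqnn T); rewrite mul1r.
Qed.

End Distributions.

(* [trace h t] is the triple (H_t, A_t, S_{t+1}) read off a longer history, and
   [None] when the history stops at or before stage [t]. *)
Fixpoint trace t0 : hist M t0 ->
    forall t, option (hist M t * action M t * state M t.+1) :=
  match t0 return hist M t0 -> forall t, option (hist M t * action M t * state M t.+1) with
  | 0 => fun _ _ => None
  | t0'.+1 => fun (h : hist M t0' * action M t0' * state M t0'.+1) t =>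
      match @eqP _ t0' t with
      | ReflectT e => Some (ecast t (hist M t * action M t * state M t.+1)%type e h)
      | ReflectF _ => trace h.1.1 t
      end
  end.

Lemma trace_last t (h : hist M t.+1) : trace h t = Some h.
Proof. by rewrite /=; case: eqP => // e; rewrite (eq_irrelevance e erefl). Qed.

Lemma trace_lt t0 (h : hist M t0.+1) t : (t < t0)%N -> trace h t = trace h.1.1 t.
Proof. by move=> tt0; rewrite /=; case: eqP => // e; rewrite e ltnn in tt0. Qed.

Lemma trace_some t0 (h : hist M t0) t : (t < t0)%N -> exists x, trace h t = Some x.
Proof.
elim: t0 h => [//|t0 IH] h; rewrite ltnS leq_eqVlt => /predU1P[->|tt0].
  by exists h; exact: trace_last.
by rewrite trace_lt //; exact: IH.
Qed.

Lemma prod_trace (F : forall t, hist M t * action M t * state M t.+1 -> R)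
    t0 (h : hist M t0.+1) :
  \prod_(t < t0.+1) oapp (F t) 1 (trace h t) =
  (\prod_(t < t0) oapp (F t) 1 (trace h.1.1 t)) * F t0 h.
Proof.
rewrite big_ord_recr; congr (_ * _); last first.
  exact: (congr1 (oapp (F t0) 1) (trace_last h)).
apply: eq_bigr => t _; exact: (congr1 (oapp (F t) 1) (trace_lt h (ltn_ord t))).
Qed.

(** With the constant 1 in place of a kernel, [hist_prob] keeps only the policy factors. The kernel
    is thus isolated as one factor per stage, which makes expectations multilinear in the stage
    kernels. *)
Lemma hist_prob_trace Q pi s t0 (h : hist M t0) :
  hist_prob Q pi s h = hist_prob (fun _ _ _ _ => 1) pi s h *
    \prod_(t < t0) oapp (fun x => Q t (cur x.1.1) x.1.2 x.2) 1 (trace h t).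
Proof.
elim: t0 h => [|t0 IH] h; first by rewrite big_ord0 mulr1.
rewrite (prod_trace (fun t x => Q t (cur x.1.1) x.1.2 x.2)).
case: h => [[h a] s'] /=; rewrite IH; ring.
Qed.

End Histories.

(** * Empirical kernels *)

Lemma sum_indicator (R : pzSemiRingType) (I : finType) (x : I) :
  \sum_y (x == y)%:R = 1 :> R.
Proof.
by rewrite (bigD1 x) //= eqxx big1 ?addr0 // => y /negbTE; rewrite eq_sym => ->.
Qed.

Section Empirical.
Variables (R : realType) (T : nat) (M : mdp R T) (n : nat).
Implicit Types (om : sample M n) (pi : policy M).

(* The transition at stage [t] is read off the [i t]-th draw. *)
Definition draw om (i : {ffun 'I_T -> 'I_n}) : trans_kernel M :=
  fun t s a s' =>
    match decP (@idP (t < T)%N) with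
    | left ltT => (om (Ordinal ltT) (s, a, i (Ordinal ltT)) == s')%:R
    | right _ => 0
    end.

Lemma drawE om i (t : 'I_T) (s : state M t) (a : action M t) (s' : state M t.+1) :
  draw om i s a s' = (om t (s, a, i t) == s')%:R.
Proof.
case: t s a s' => t ltT s a s'; rewrite /draw /=.
by case: decP => // ltT'; rewrite (bool_irrelevance ltT' ltT).
Qed.

Lemma empiricalE om (t : 'I_T) (s : state M t) (a : action M t) (s' : state M t.+1) :
  empirical om s a s' = n%:R^-1 * \sum_(j < n) (om t (s, a, j) == s')%:R.
Proof.
case: t s a s' => t ltT s a s'; rewrite /empirical /=.
case: decP => // ltT'; rewrite (bool_irrelevance ltT' ltT) mulrC; congr (_ * _).
by rewrite -sum1_card natr_sum big_mkcond; apply: eq_bigr => j _; rewrite !inE; case: (_ == _).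
Qed.

Lemma draw_kernel om i : is_kernel (draw om i).
Proof.
move=> t s a ltT; have E := @drawE om i (Ordinal ltT) s a.
split=> [s'|]; first by rewrite E ler0n.
rewrite (eq_bigr _ (fun s' _ => E s')).
exact: sum_indicator.
Qed.

Lemma empirical_kernel om : (0 < n)%N -> is_kernel (empirical om).
Proof.
move=> n0 t s a ltT; have E := @empiricalE om (Ordinal ltT) s a.
split=> [s'|].
  by rewrite E mulr_ge0 ?invr_ge0 ?ler0n //; apply: sumr_ge0 => j _; rewrite ler0n.
rewrite (eq_bigr _ (fun s' _ => E s')) -mulr_sumr exchange_big /=.
rewrite (eq_bigr (fun=> 1)) => [|j _]; last first.
  exact: sum_indicator.
by rewrite sumr_const card_ord -[1 *+ n]/(n%:R) mulVf // pnatr_eq0 -lt0n.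
Qed.

Lemma expect_trace (Q : trans_kernel M) pi s g :
  expect Q pi s g = \sum_w hist_prob (fun _ _ _ _ => 1) pi s w.1 * pi T w.1 w.2 * g w *
    \prod_(t < T) oapp (fun x => Q t (cur x.1.1) x.1.2 x.2) 1 (trace w.1 t).
Proof.
by apply: eq_bigr => w _; rewrite hist_prob_trace; ring.
Qed.

(** A history uses each stage exactly once, so the product over stages of averages of [n] indicators
    expands into a sum over all choices of one draw index per stage. *)
Lemma expect_empirical om pi s g : expect (empirical om) pi s g =
  (n%:R ^+ T)^-1 * \sum_i expect (draw om i) pi s g.
Proof.
under eq_bigr do rewrite expect_trace.
rewrite expect_trace exchange_big mulr_sumr /=; apply: eq_bigr => w _.
rewrite -mulr_sumr mulrCA; congr (_ * _).
pose F t j : R := oapp (fun x => (om t (cur x.1.1, x.1.2, j) == x.2)%:R) 1 (trace w.1 t).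
transitivity (\prod_(t < T) (n%:R^-1 * \sum_j F t j)).
  apply: eq_bigr => t _; rewrite /F.
  by have [x ->] := trace_some w.1 (ltn_ord t); rewrite /= empiricalE.
rewrite big_split /= prodr_const card_ord exprVn; congr (_ * _).
rewrite bigA_distr_bigA; apply: eq_bigr => i _; apply: eq_bigr => t _.
by rewrite /F; have [x ->] := trace_some w.1 (ltn_ord t); rewrite /= drawE.
Qed.

End Empirical.

(** * Averages of independent copies of the process *)

Section Blocks.
Variables (R : realType) (T : nat) (M : mdp R T) (m : nat).
Local Notation n := m.+1.
Implicit Types (pi : policy M) (s : state M 0) (c : {ffun 'I_T -> 'I_n}).

(** The addition is modulo [n], which is why [n] is taken of the form [m.+1]. *)
Definition cyc_shift c (j : 'I_n) : {ffun 'I_T -> 'I_n} := [ffun t => c t + j].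

(** Each shift permutes the index choices, so averaging over the shifts as well changes nothing. *)
Lemma expect_empirical_shift (om : sample M n) pi s g :
  expect (empirical om) pi s g = (n%:R ^+ T)^-1 *
    \sum_c n%:R^-1 * \sum_j expect (draw om (cyc_shift c j)) pi s g.
Proof.
rewrite expect_empirical; congr (_ * _).
rewrite -mulr_sumr [X in _ = _ * X]exchange_big /=.
rewrite [X in _ = _ * X](eq_bigr (fun=> \sum_i expect (draw om i) pi s g)) => [|j _].
  by rewrite sumr_const card_ord -[X in _ * X]mulr_natl mulKf ?pnatr_eq0.
rewrite [RHS](reindex (cyc_shift^~ j)) //.
exists (cyc_shift^~ (- j)) => c _; apply/ffunP => t; rewrite !ffunE.
  by rewrite addrK.
by rewrite addrNK.
Qed.

(* The kernels [draw om (cyc_shift c j)], [j < n], use disjoint sets of draws, hence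
   are independent. *)
Lemma Esample_blocks c pi s g :
  Esample (fun om : sample M n => \prod_j expect (draw om (cyc_shift c j)) pi s g) =
  expect (@trans R T M) pi s g ^+ n.
Proof.
pose A w := hist_prob (fun _ _ _ _ => 1) pi s w.1 * pi T w.1 w.2 * g w.
pose tr (w : hist M T * action M T) (t : 'I_T) := sval (cid (trace_some w.1 (ltn_ord t))).
have trE w (t : 'I_T) : trace w.1 t = Some (tr w t) by rewrite /tr; case: cid.
have eE Q : expect Q pi s g = \sum_w A w *
    \prod_(t < T) Q t (cur (tr w t).1.1) (tr w t).1.2 (tr w t).2.
  rewrite expect_trace; apply: eq_bigr => w _; congr (_ * _).
  by apply: eq_bigr => t _; rewrite trE.
(* After expansion over one outcome [W j] per copy, the factors are reindexed by draws: at stage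
   [t], draw [i] serves only copy [i - c t]. This is the shape required by [Esample_prod]. *)
transitivity (Esample (fun om : sample M n =>
    \sum_(W : {ffun 'I_n -> hist M T * action M T}) (\prod_j A (W j)) *
      \prod_(t < T) \prod_i
        (om t (cur (tr (W (i - c t)) t).1.1, (tr (W (i - c t)) t).1.2, i)
           == (tr (W (i - c t)) t).2)%:R)).
  apply: eq_bigr => om _; congr (_ * _).
  under eq_bigr do rewrite eE.
  rewrite bigA_distr_bigA; apply: eq_bigr => W _; rewrite big_split /=; congr (_ * _).
  rewrite exchange_big /=; apply: eq_bigr => t _.
  rewrite [RHS](reindex (fun j => c t + j)) /=; last first.
    by exists (fun j => - c t + j) => j _; rewrite ?addKr ?addNKr.
  apply: eq_bigr => j _; rewrite drawE ffunE.
  by have -> : c t + j - c t = j by rewrite addrAC subrr add0r.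
rewrite Esample_sum.
transitivity (\sum_(W : {ffun 'I_n -> hist M T * action M T}) \prod_j (A (W j) *
    \prod_(t < T) trans (cur (tr (W j) t).1.1) (tr (W j) t).1.2 (tr (W j) t).2)).
  apply: eq_bigr => W _; rewrite EsampleZ [RHS]big_split /=; congr (_ * _).
  rewrite (Esample_prod (fun t i => ((cur (tr (W (i - c t)) t).1.1, (tr (W (i - c t)) t).1.2)))
    (fun t i (s' : state M t.+1) => (s' == (tr (W (i - c t)) t).2)%:R)).
  rewrite [RHS]exchange_big /=; apply: eq_bigr => t _.
  rewrite [RHS](reindex (fun i => i - c t)) /=; last first.
    by exists (fun j => j + c t) => j _; rewrite ?addrK ?addrNK.
  apply: eq_bigr => i _; rewrite (bigD1 (tr (W (i - c t)) t).2) //= eqxx mulr1.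
  by rewrite big1 ?addr0 // => z /negbTE ->; rewrite mulr0.
rewrite -(bigA_distr_bigA (fun _ w => A w *
    \prod_(t < T) trans (cur (tr w t).1.1) (tr w t).1.2 (tr w t).2)).
by rewrite -eE prodr_const card_ord.
Qed.

End Blocks.

(** * Concentration for a fixed policy *)

(** Inverting, it suffices to bound [expR t] from below with t = x^2 - x. For x >= 0 the tangent
    bound works since (1 + x)(1 + t) = 1 + x^3. For x < 0 that product is below 1, and the tangent
    bound is applied to [expR (t / 2)] and squared instead. *)
Lemma expR_subsqr_le (R : realType) (x : R) : `|x| <= 4^-1 -> expR (x - x ^+ 2) <= 1 + x.
Proof.
rewrite ler_norml => /andP[x1 x2].
have x0 : 0 < 1 + x by lra.
rewrite -[x - _]opprB expRN invf_ple ?posrE ?expR_gt0 // -[_ - x]/(x ^+ 2 - x).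
set t := x ^+ 2 - x.
have [x_ge0|x_lt0] := leP 0 x.
  apply: le_trans (expR_ge1Dx t).
  rewrite -div1r ler_pdivrMr // /t; nra.
have -> : t = t / 2 + t / 2 by lra.
have t0 : 0 <= 1 + t / 2 by rewrite /t; nra.
rewrite expRD; apply: (@le_trans _ _ ((1 + t / 2) * (1 + t / 2))).
  rewrite -div1r ler_pdivrMr // /t.
  set y := - x; have -> : x = - y by rewrite /y opprK.
  have y0 : 0 <= y by rewrite /y; lra.
  have y4 : y <= 4^-1 by rewrite /y; lra.
  (* The product of 1 - y and the square equals 1 - y^3 + y^2 (1 - y)(1 + y)^2 / 4. *)
  have H : 4 * y <= (1 - y) * (1 + y) ^+ 2 by nra.
  nra.
by rewrite ler_pM ?expR_ge1Dx.
Qed.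

(** Jensen's inequality: the tangent to [expR] at the mean lies below it, and its linear terms
    cancel in the average. *)
Lemma expR_mean_le (R : realType) (I : finType) (y : I -> R) : (0 < #|I|)%N ->
  expR (#|I|%:R^-1 * \sum_i y i) <= #|I|%:R^-1 * \sum_i expR (y i).
Proof.
move=> I0; have N0 : 0 < #|I|%:R :> R by rewrite ltr0n.
set mu := _ * \sum_i y i.
rewrite -(ler_pM2l N0) mulrA mulfV ?gt_eqF // mul1r.
apply: (@le_trans _ _ (\sum_i expR mu * (1 + (y i - mu)))); last first.
  apply: ler_sum => i _; rewrite -[y i in leRHS](subrKC mu) expRD.
  by rewrite ler_wpM2l ?expR_ge0 ?expR_ge1Dx.
rewrite -mulr_sumr big_split /= sumrB !sumr_const /mu -[1 *+ _]/(#|_|%:R).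
rewrite -[X in _ - X]mulr_natl mulrA mulfV ?gt_eqF // mul1r subrr addr0.
by rewrite mulrC.
Qed.

Section Concentration.
Variables (R : realType) (T : nat) (M : mdp R T).
Local Notation P := (@trans R T M).

Lemma trans_kernelP : is_kernel P.
Proof. by move=> t s a; exact: trans_distr. Qed.

Lemma expect_norm_le (Q : trans_kernel M) (pi : policy M) (s : state M 0) g B :
  is_kernel Q -> is_policy pi -> (forall w, `|g w| <= B) ->
  `|expect Q pi s g| <= B.
Proof.
move=> kQ ppi gB; rewrite ler_norml -{1}(expect_cst s kQ ppi (- B)).
rewrite -{2}(expect_cst s kQ ppi B); apply/andP.
by split; apply: le_expect => // w; have := gB w; rewrite ler_norml => /andP[].
Qed.

(** Chernoff bound with parameter [r], in which 1 + r Y replaces the exponential of r Y. Being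
    affine in Y, it is again an expectation over histories, so [Esample_blocks] gives the exact mean
    (1 + r V)^n of the product over copies; the replacement costs (r B)^2 per copy. *)
Lemma sample_prob_expect_ge n (pi : policy M) (s : state M 0) g (B r e : R) :
  (0 < n)%N -> is_policy pi -> (forall w, `|g w| <= B) -> 0 <= r -> r * B <= 4^-1 ->
  sample_prob (fun om : sample M n =>
    expect P pi s g + e <= expect (empirical om) pi s g) <=
  expR (- (n%:R * (r * e - (r * B) ^+ 2))).
Proof.
case: n => [//|m] _ ppi gB r0 rB; set n := m.+1.
set V := expect P pi s g.
pose K := expR (- (n%:R * (r * (V + e) - (r * B) ^+ 2))).
pose Y (om : sample M n) c j := expect (draw om (cyc_shift c j)) pi s g.
pose Z (om : sample M n) c j := expect (draw om (cyc_shift c j)) pi s (fun w => 1 + r * g w).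
have ZE om c j : Z om c j = 1 + r * Y om c j.
  by rewrite /Z expect_affine expect_cst //; exact: draw_kernel.
have YB om c j : `|r * Y om c j| <= r * B.
  by rewrite normrM (ger0_norm r0) ler_wpM2l // expect_norm_le //; exact: draw_kernel.
have expZ om c j : expR (r * Y om c j - (r * B) ^+ 2) <= Z om c j.
  rewrite ZE; apply: le_trans (expR_subsqr_le (le_trans (YB om c j) rB)).
  rewrite ler_expR lerD2l lerN2 -[leLHS]real_normK ?num_real //.
  by rewrite lerXn2r ?nnegrE ?(le_trans _ (YB om c j)).
have Z0 om c j : 0 <= Z om c j by apply: le_trans (expZ om c j); exact: expR_ge0.
have nT : #|{ffun 'I_T -> 'I_n}|%:R = n%:R ^+ T :> R.
  by rewrite card_ffun !card_ord natrX.
apply: (@le_trans _ _ (Esample (fun om : sample M n =>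
  K * ((n%:R ^+ T)^-1 * \sum_(c : {ffun 'I_T -> 'I_n}) \prod_j Z om c j)))).
  apply: sample_prob_le => om.
    rewrite mulr_ge0 ?expR_ge0 // mulr_ge0 ?invr_ge0 ?exprn_ge0 ?ler0n //.
    by apply: sumr_ge0 => c _; exact: prodr_ge0.
  move=> Ve; rewrite -[leLHS](expRxMexpNx_1 (n%:R * (r * (V + e) - (r * B) ^+ 2))).
  rewrite mulrC ler_wpM2l ?expR_ge0 //.
  apply: (@le_trans _ _ (expR (n%:R * (r * expect (empirical om) pi s g - (r * B) ^+ 2)))).
    by rewrite ler_expR ler_wpM2l ?ler0n // lerD2r ler_wpM2l.
  (* The exponent is an average over index choices of sums over the [n] copies, so Jensen applies to
     the outer average. *)
  have -> : n%:R * (r * expect (empirical om) pi s g - (r * B) ^+ 2) =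
     #|{ffun 'I_T -> 'I_n}|%:R^-1 *
     \sum_(c : {ffun 'I_T -> 'I_n}) \sum_j (r * Y om c j - (r * B) ^+ 2).
    have -> : expect (empirical om) pi s g = (n%:R ^+ T)^-1 *
        (n%:R^-1 * \sum_(c : {ffun 'I_T -> 'I_n}) \sum_j Y om c j).
      by rewrite expect_empirical_shift -mulr_sumr.
    have -> : \sum_(c : {ffun 'I_T -> 'I_n}) \sum_j (r * Y om c j - (r * B) ^+ 2) =
        r * (\sum_(c : {ffun 'I_T -> 'I_n}) \sum_j Y om c j) -
        n%:R ^+ T * (n%:R * (r * B) ^+ 2).
      under eq_bigr do rewrite sumrB -mulr_sumr sumr_const card_ord.
      by rewrite sumrB -mulr_sumr sumr_const -[_ *+ #|_|]mulr_natl nT mulr_natl.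
    rewrite nT;
    have n0 : n%:R != 0 :> R by rewrite pnatr_eq0.
    have nT0 : n%:R ^+ T != 0 :> R by rewrite expf_neq0.
    by field; rewrite nT0 n0.
  apply: le_trans (expR_mean_le _ _) _; first by rewrite card_ffun !card_ord expn_gt0.
  rewrite nT ler_wpM2l ?invr_ge0 ?exprn_ge0 ?ler0n //.
  apply: ler_sum => c _; rewrite expR_sum; apply: ler_prod => j _.
  by rewrite expR_ge0 expZ.
rewrite EsampleZ EsampleZ Esample_sum.
under eq_bigr do rewrite Esample_blocks.
rewrite sumr_const -[_ *+ #|_|]mulr_natl nT mulKf; last first.
  by rewrite expf_neq0 // pnatr_eq0.
rewrite expect_affine expect_cst //; last exact: trans_kernelP.
have V1 : 0 <= 1 + r * V.
  suff : `|r * V| <= r * B by rewrite ler_norml; lra.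
  by rewrite normrM (ger0_norm r0) ler_wpM2l // expect_norm_le //; exact: trans_kernelP.
apply: (@le_trans _ _ (K * expR (r * V) ^+ n)).
  by rewrite ler_wpM2l ?expR_ge0 // lerXn2r ?nnegrE ?expR_ge0 ?expR_ge1Dx.
rewrite /K -expRM_natl -expRD ler_expR; lra.
Qed.

End Concentration.

(** * Dynamic programming *)

Section DynamicProgramming.
Variables (R : realType) (T : nat) (M : mdp R T).
Variable g : forall t, hist M t -> action M t -> R.
Local Notation P := (@trans R T M).

(** An option, because action spaces beyond stage [T] may be empty; up to stage [T] it is never
    [None]. *)
Definition best t (f : action M t -> R) : option (action M t) :=
  [pick a | [forall b, f a <= f b]].

Definition min_action t (f : action M t -> R) : R := oapp f 0 (best f).

Lemma best_some t (f : action M t -> R) : (t <= T)%N ->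
  exists2 a, best f = Some a & forall b, f a <= f b.
Proof.
move=> /(@action_gt0 _ _ M)/card_gt0P[a0 _]; rewrite /best.
case: pickP => [a /forallP fa|none]; first by exists a.
have /negP[] := negbT (none [arg min_(a < a0) f a]%O).
by case: arg_minP => //= a _ fa; apply/forallP => b; exact: fa.
Qed.

(* Optimal value of playing [a] after [h] when [k] further transitions follow. *)
Fixpoint qval k : forall t, hist M t -> action M t -> R :=
  match k with
  | 0 => g
  | k'.+1 => fun t h a =>
      \sum_s' P (cur h) a s' * min_action (@qval k' t.+1 (h, a, s'))
  end.

Definition value t (h : hist M t) : R := min_action (@qval (T - t) t h).

Definition greedy : policy M :=
  fun t h a => (best (@qval (T - t) t h) == Some a)%:R.

Lemma qvalE t (h : hist M t) a : (t < T)%N ->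
  qval (T - t) h a = \sum_s' P (cur h) a s' * @value t.+1 (h, a, s').
Proof. by move=> tT; rewrite -subnSK. Qed.

Lemma value_le t (h : hist M t) a : (t <= T)%N -> value h <= qval (T - t) h a.
Proof.
by move=> tT; rewrite /value /min_action; have [b -> ?] := best_some (@qval (T - t) t h) tT.
Qed.

Lemma greedyE t (h : hist M t) : (t <= T)%N ->
  \sum_a greedy h a * qval (T - t) h a = value h.
Proof.
move=> tT; rewrite /greedy /value /min_action.
have [b -> _] := best_some (@qval (T - t) t h) tT.
rewrite (bigD1 b) //= eqxx mul1r big1 ?addr0 // => c /negbTE bc.
by rewrite -[_ == _]/(b == c) eq_sym bc mul0r.
Qed.

Lemma greedy_policy : is_policy greedy.
Proof.
move=> t h tT; split=> [a|]; first by rewrite ler0n.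
have [b E _] := best_some (@qval (T - t) t h) tT.
by rewrite -[RHS](@sum_indicator R _ b); apply: eq_bigr => a _; rewrite /greedy E.
Qed.

(** Under [greedy] the mean of [value] along the history is the same at all stages, and at stage [T]
    it is the mean of [g]. *)
Lemma expect_greedy s : expect P greedy s (fun w => g w.1 w.2) = value (t := 0) s.
Proof.
have H t : (t <= T)%N -> hist_exp P greedy s (@value t) = value (t := 0) s.
  elim: t => [|t IH] tT.
    rewrite /hist_exp (bigD1 s) //= eqxx mul1r big1 ?addr0 // => h /negbTE ->.
    by rewrite mul0r.
  rewrite hist_expS -IH ?(ltnW tT) //; apply: eq_bigr => h _; congr (_ * _).
  rewrite -greedyE ?(ltnW tT) //; apply: eq_bigr => a _.
  by rewrite qvalE.
rewrite expectE -(H T) //; apply: eq_bigr => h _; congr (_ * _).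
rewrite -greedyE //; apply: eq_bigr => a _.
by rewrite subnn.
Qed.

Lemma value_le_sum (pi : policy M) t (h : hist M t) : is_policy pi -> (t <= T)%N ->
  value h <= \sum_a pi t h a * qval (T - t) h a.
Proof.
move=> ppi tT; have [p0 p1] := ppi t h tT.
rewrite -[value h]mul1r -p1 mulr_suml; apply: ler_sum => a _.
by rewrite ler_wpM2l ?value_le.
Qed.

(** Under any policy [value] is a submartingale, as no average over actions beats the best
    action. *)
Lemma value_le_expect (pi : policy M) s : is_policy pi ->
  value (t := 0) s <= expect P pi s (fun w => g w.1 w.2).
Proof.
move=> ppi; have kP := @trans_kernelP R T M.
have H t : (t <= T)%N -> value (t := 0) s <= hist_exp P pi s (@value t).
  elim: t => [|t IH] tT.
    rewrite /hist_exp (bigD1 s) //= eqxx mul1r big1 ?addr0 // => h /negbTE ->.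
    by rewrite mul0r.
  apply: (le_trans (IH (ltnW tT))); rewrite hist_expS.
  apply: le_hist_exp => // [|h]; first exact: ltnW.
  apply: le_trans (value_le_sum h ppi (ltnW tT)) _.
  by apply: ler_sum => a _; rewrite qvalE.
apply: le_trans (H T (leqnn T)) _; rewrite expectE; apply: le_hist_exp => // h.
by apply: le_trans (value_le_sum h ppi _) _; rewrite // subnn.
Qed.

(** * Deviations of the empirical model, uniform over policies *)

Section Bounded.
Variable B : R.
Hypothesis gB : forall t (h : hist M t) a, (t <= T)%N -> `|g h a| <= B.

Lemma value_norm_le t (h : hist M t) : (t <= T)%N -> `|value h| <= B.
Proof.
have H k : forall t (h : hist M t) a, (t + k)%N = T -> `|qval k h a| <= B.
  elim: k => [|k IH] {}t {}h a tk /=.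
    by apply: gB; rewrite -tk addn0.
  have ltT : (t < T)%N by rewrite -tk addnS ltnS leq_addr.
  have [p0 p1] := trans_distr (cur h) a ltT.
  apply: le_trans (ler_norm_sum _ _ _) _; rewrite -[B]mul1r -p1 mulr_suml.
  apply: ler_sum => s' _; rewrite normrM (ger0_norm (p0 _)) ler_wpM2l //.
  rewrite /min_action.
  have [b -> _] := best_some (@qval k t.+1 (h, a, s')) ltT.
  by apply: IH; rewrite addSnnS.
move=> tT; rewrite /value /min_action.
have [b -> _] := best_some (@qval (T - t) t h) tT.
by apply: H; rewrite subnKC.
Qed.

Variable r : R.
Hypotheses (r0 : 0 <= r) (rB : r * B <= 4^-1).

(** An affine stand-in for the exponential utility expR (- r V): its mean over the next state stays
    affine in the value, while its logarithm is within (r B)^2 of - r V. *)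
Definition util t (h : hist M t) : R := 1 - r * value h.

Lemma util_gt0 t (h : hist M t) : (t <= T)%N -> 0 < util h.
Proof.
move=> tT; rewrite /util; set v := value h.
have : `|r * v| <= r * B by rewrite normrM (ger0_norm r0) ler_wpM2l // value_norm_le.
by rewrite ler_norml => /andP[]; move: rB; lra.
Qed.

Lemma sum_util t (h : hist M t) a : (t < T)%N ->
  \sum_s' P (cur h) a s' * @util t.+1 (h, a, s') = 1 - r * qval (T - t) h a.
Proof.
move=> tT; rewrite qvalE // mulr_sumr; have [_ <-] := trans_distr (cur h) a tT.
by rewrite -sumrB; apply: eq_bigr => s' _; rewrite /util; ring.
Qed.

Lemma sum_util_gt0 t (h : hist M t) a : (t < T)%N ->
  0 < \sum_s' P (cur h) a s' * @util t.+1 (h, a, s').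
Proof.
move=> tT; have [p0 p1] := trans_distr (cur h) a tT.
(* Every [util] is at least 3/4 because r B <= 1/4, hence so is the average. *)
have [q q0 q34] : exists2 q : R, 0 < q & q <= 3 / 4 by exists (3 / 4); lra.
apply: (lt_le_trans q0).
rewrite -[leLHS]mul1r -p1 mulr_suml; apply: ler_sum => s' _.
rewrite ler_wpM2l // /util; set v := value _.
have : `|r * v| <= r * B by rewrite normrM (ger0_norm r0) ler_wpM2l // value_norm_le.
by rewrite ler_norml => /andP[]; move: rB; lra.
Qed.

Variables (n : nat) (n0 : (0 < n)%N).

Definition log_dev (om : sample M n) t (h : hist M t) (a : action M t) : R :=
  \sum_s' empirical om (cur h) a s' * ln (@util t.+1 (h, a, s'))
  - ln (\sum_s' P (cur h) a s' * @util t.+1 (h, a, s')).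

Fixpoint cum_dev (om : sample M n) t : hist M t -> R :=
  match t return hist M t -> R with
  | 0 => fun=> 0
  | t'.+1 => fun h : hist M t' * action M t' * state M t'.+1 =>
      cum_dev om h.1.1 + log_dev om h.1.1 h.1.2
  end.

Lemma expR_cum_dev (om : sample M n) t0 (h : hist M t0) :
  expR (n%:R * cum_dev om h) =
  \prod_(t < t0) oapp (fun x => expR (n%:R * log_dev om x.1.1 x.1.2)) 1 (trace h t).
Proof.
elim: t0 h => [|t0 IH] h; first by rewrite big_ord0 mulr0 expR0.
rewrite (prod_trace (fun t x => expR (n%:R * log_dev om x.1.1 x.1.2))) /=.
by rewrite mulrDr expRD IH.
Qed.

(** The factor [n] turns the empirical mean into a sum over draws, and the exponential into a
    product of ratios, each of mean 1 under the true transition law. *)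
Lemma expR_log_dev (om : sample M n) (t : 'I_T) (h : hist M t) a :
  expR (n%:R * log_dev om h a) =
  \prod_(i < n) (@util t.+1 (h, a, om t (cur h, a, i)) /
    \sum_s' P (cur h) a s' * @util t.+1 (h, a, s')).
Proof.
set pu := \sum_s' _.
have pu0 : 0 < pu := sum_util_gt0 h a (ltn_ord t).
have nn0 : n%:R != 0 :> R by rewrite pnatr_eq0 -lt0n.
rewrite /log_dev -/pu.
have -> : \sum_s' empirical om (cur h) a s' * ln (@util t.+1 (h, a, s')) =
    n%:R^-1 * \sum_(i < n) ln (@util t.+1 (h, a, om t (cur h, a, i))).
  under eq_bigr do rewrite empiricalE -mulrA mulr_suml.
  rewrite -mulr_sumr exchange_big /=; congr (_ * _); apply: eq_bigr => i _.
  rewrite (bigD1 (om t (cur h, a, i))) //= eqxx mul1r big1 ?addr0 // => s'.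
  by rewrite eq_sym => /negbTE ->; rewrite mul0r.
rewrite mulrBr mulrA mulfV // mul1r expRB expRM_natl lnK ?posrE //.
rewrite expR_sum prodf_div prodr_const card_ord; congr (_ / _).
by apply: eq_bigr => i _; rewrite lnK ?posrE ?util_gt0.
Qed.

(** Once the history is fixed, each stage reads its draws at one state-action pair, so all ratios
    are independent. *)
Lemma Esample_cum_dev (h : hist M T) :
  Esample (fun om : sample M n => expR (n%:R * cum_dev om h)) = 1.
Proof.
pose tr (t : 'I_T) := sval (cid (trace_some h (ltn_ord t))).
have trE (t : 'I_T) : trace h t = Some (tr t) by rewrite /tr; case: cid.
pose f (t : 'I_T) (i : 'I_n) (s' : state M t.+1) :=
  @util t.+1 ((tr t).1, s') /
    \sum_s' P (cur (tr t).1.1) (tr t).1.2 s' * @util t.+1 ((tr t).1, s').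
transitivity (Esample (fun om : sample M n => \prod_(t < T) \prod_i
    f t i (om t ((cur (tr t).1.1, (tr t).1.2), i)))).
  apply: eq_bigr => om _; congr (_ * _); rewrite expR_cum_dev.
  apply: eq_bigr => t _; rewrite trE /= expR_log_dev.
  by rewrite /f; case: (tr t) => [[]].
rewrite (Esample_prod (fun t _ => (cur (tr t).1.1, (tr t).1.2)) f).
rewrite big1 // => t _; rewrite big1 // => i _; rewrite /f /=.
under eq_bigr do rewrite mulrA.
rewrite -mulr_suml divff //; case: (tr t) => [[h' a] s'] /=.
by rewrite gt_eqF // sum_util_gt0.
Qed.

(** Markov's inequality and a union bound over histories; the logarithm of their number accounts for
    the extra factor [T] in the optimal case. *)
Lemma sample_prob_cum_dev (c : R) :
  sample_prob (fun om : sample M n => [exists h : hist M T, c < cum_dev om h]) <=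
  #|hist M T|%:R * expR (- (n%:R * c)).
Proof.
apply: le_trans (sample_prob_exists _) _.
rewrite mulr_natl -sumr_const; apply: ler_sum => h _.
apply: (@le_trans _ _ (Esample (fun om : sample M n =>
    expR (- (n%:R * c)) * expR (n%:R * cum_dev om h)))).
  apply: sample_prob_le => om; first by rewrite mulr_ge0 ?expR_ge0.
  move=> ch; rewrite -expRD -[leLHS]expR0 ler_expR addrC subr_ge0.
  by rewrite ler_wpM2l ?ler0n // ltW.
by rewrite EsampleZ Esample_cum_dev mulr1.
Qed.

(** The assumption on [cum_dev] does not mention [pi], so one good event serves all policies,
    including those chosen after seeing the samples. *)
Lemma value_le_expect_empirical (om : sample M n) (pi : policy M) s (c : R) :
  is_policy pi -> (forall h : hist M T, cum_dev om h <= c) ->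
  r * value (t := 0) s <=
  r * expect (empirical om) pi s (fun w => g w.1 w.2) + (r * B) ^+ 2 + c.
Proof.
move=> ppi devc; have kQ := empirical_kernel om n0.
set Q := empirical om.
(* Under the empirical chain [ln util - cum_dev] is a supermartingale: subtracting [log_dev]
   replaces the empirical mean of [ln util] by [ln (1 - r * qval)], which is at most [ln util] since
   [value] is at most [qval]. *)
have H t : (t <= T)%N ->
    hist_exp Q pi s (fun h : hist M t => ln (util h) - cum_dev om h) <=
    ln (@util 0 s).
  elim: t => [|t IH] tT.
    rewrite /hist_exp (bigD1 s) //= eqxx mul1r subr0 big1 ?addr0 // => h /negbTE ->.
    by rewrite mul0r.
  apply: le_trans (IH (ltnW tT)); rewrite hist_expS.
  apply: le_hist_exp => // [|h]; first exact: ltnW.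
  have [p0 p1] := ppi t h (ltnW tT).
  rewrite -[leRHS]mul1r -p1 mulr_suml; apply: ler_sum => a _.
  rewrite ler_wpM2l //=.
  have -> : \sum_s' Q t (cur h) a s' *
      (ln (@util t.+1 (h, a, s')) - (cum_dev om h + log_dev om h a)) =
      ln (1 - r * qval (T - t) h a) - cum_dev om h.
    under eq_bigr do rewrite mulrBr.
    rewrite sumrB -mulr_suml; have [_ ->] := kQ t (cur h) a tT.
    rewrite /log_dev sum_util // /Q; ring.
  rewrite lerD2r ler_ln ?posrE ?util_gt0 ?(ltnW tT) //.
    by rewrite lerD2l lerN2 ler_wpM2l // value_le // ltnW.
  by rewrite -sum_util // sum_util_gt0.
have {H} := H T (leqnn T).
have lnV : ln (@util 0 s) <= - (r * value (t := 0) s).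
  have := util_gt0 (t := 0) s (leq0n T); rewrite /util => u0.
  by apply: le_ln1Dx; lra.
have VT : hist_exp Q pi s (@value T) <= expect Q pi s (fun w => g w.1 w.2).
  rewrite expectE; apply: le_hist_exp => // h.
  by apply: le_trans (value_le_sum h ppi (leqnn T)) _; rewrite subnn.
have : - ((r * B) ^+ 2 + c) + - r * hist_exp Q pi s (@value T) <=
    hist_exp Q pi s (fun h : hist M T => ln (util h) - cum_dev om h).
  rewrite -{1}(hist_exp_cst s kQ ppi (- _) (leqnn T)) -hist_exp_affine.
  apply: le_hist_exp => // h.
  (* The initial stage used ln (1 - r V) <= - r V; the horizon needs a converse, which
     [expR_subsqr_le] supplies at the price (r B)^2. *)
  suff : - (r * value h) - (r * B) ^+ 2 <= ln (util h).
    by have := devc h; lra.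
  have vB : `|r * value h| <= r * B.
    by rewrite normrM (ger0_norm r0) ler_wpM2l // value_norm_le.
  rewrite -[leLHS]expRK ler_ln ?posrE ?expR_gt0 ?util_gt0 //.
  apply: (@le_trans _ _ (expR (- (r * value h) - (- (r * value h)) ^+ 2))).
    rewrite ler_expR lerD2l lerN2 sqrrN -[leLHS]real_normK ?num_real //.
    by rewrite lerXn2r ?nnegrE ?(le_trans _ vB).
  by apply: expR_subsqr_le; rewrite normrN (le_trans vB).
have := ler_wpM2l r0 VT.
lra.
Qed.

End Bounded.
End DynamicProgramming.

(** * Conjugate of the Cressie-Read divergence *)

Section CressieRead.
Variables (R : realType) (k : R).
Hypothesis k1 : 1 < k.

Local Notation phi x := ((x `^ k - k * x + k - 1) / (k * (k - 1))).
Local Notation conj l := (conjugate (scale_fun l (cressie_read k))).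

(** This is Young's inequality for [x] and a^(k-1) with exponents k and k/(k-1). *)
Lemma powR_tangent (a x : R) : 0 < a -> 0 <= x ->
  a `^ k + k * a `^ (k - 1) * (x - a) <= x `^ k.
Proof.
move=> a0 x0; have k0 : 0 < k by move: k1; lra.
have km0 : 0 < k - 1 by move: k1; lra.
have := @conjugate_powR _ x (a `^ (k - 1)) k (k / (k - 1)) x0 (powR_ge0 _ _) k0.
rewrite divr_gt0 // => /(_ isT) H.
have {H} := H ltac:(by field; rewrite !gt_eqF).
rewrite -powRrM mulrCA mulfV ?gt_eqF // mulr1 invf_div.
have aE : a * a `^ (k - 1) = a `^ k by rewrite mulr_powRB1 // ltW.
have -> : a `^ k * ((k - 1) / k) = (k - 1) * a `^ k / k by field; rewrite gt_eqF.
rewrite -mulrDl ler_pdivlMr // => H.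
have -> : k * a `^ (k - 1) * (x - a) = x * a `^ (k - 1) * k - k * (a * a `^ (k - 1)) by ring.
rewrite aE; lra.
Qed.

Lemma phi_tangent (a x : R) : 0 < a -> 0 <= x ->
  (a `^ (k - 1) - 1) / (k - 1) * (x - a) <= phi x - phi a.
Proof.
move=> a0 x0; have := powR_tangent a0 x0.
have k0 : 0 < k by move: k1; lra.
have km0 : 0 < k - 1 by move: k1; lra.
move=> H; rewrite -mulrBl ler_pdivlMr ?mulr_gt0 //.
have -> : (a `^ (k - 1) - 1) / (k - 1) * (x - a) * (k * (k - 1)) =
  k * a `^ (k - 1) * (x - a) - k * (x - a) by field; rewrite gt_eqF.
lra.
Qed.

Lemma phi1 : phi (1 : R) = 0.
Proof. by rewrite powR1 /= mulr1 subrK subrr mul0r. Qed.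

Lemma phi_ge0 (x : R) : 0 <= x -> 0 <= phi x.
Proof.
by move=> x0; have := phi_tangent ltr01 x0; rewrite phi1 powR1 subrr !mul0r subr0.
Qed.

(** Negative [x] contribute -oo to the supremum, also when l = 0, by the convention 0 * +oo =
    +oo. *)
Lemma conj_le (l y : R) (b : \bar R) :
  (forall x : R, 0 <= x -> ((x * y - l * phi x)%:E <= b)%E) -> (conj l y <= b)%E.
Proof.
move=> H; apply: ge_ereal_sup => _ [x _ <-].
rewrite /scale_fun /cressie_read; case: (boolP (0 <= x)) => x0 /=; first exact: H.
by rewrite leNye.
Qed.

Lemma le_conj (l y x : R) : 0 <= x -> ((x * y - l * phi x)%:E <= conj l y)%E.
Proof.
move=> x0; apply: ereal_sup_ubound; exists x => //.
by rewrite /scale_fun /cressie_read x0 /=.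
Qed.

Lemma conj_ge (l y : R) : (y%:E <= conj l y)%E.
Proof. by have := le_conj l y ler01; rewrite phi1 mulr0 subr0 mul1r. Qed.

Lemma conj_antitone (l l' y : R) : l <= l' -> (conj l' y <= conj l y)%E.
Proof.
move=> ll; apply: conj_le => x x0; apply: le_trans (le_conj l y x0).
by rewrite lee_fin lerD2l lerN2 ler_wpM2r // phi_ge0.
Qed.

Lemma conj_monotone (l y y' : R) : y <= y' -> (conj l y <= conj l y')%E.
Proof.
move=> yy; apply: conj_le => x x0; apply: le_trans (le_conj l y' x0).
by rewrite lee_fin lerD2r ler_wpM2l.
Qed.

Lemma conj_le0 (l y : R) : 0 <= l -> y <= 0 -> (conj l y <= 0)%E.
Proof.
move=> l0 y0; apply: conj_le => x x0; rewrite lee_fin subr_le0.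
by apply: (@le_trans _ _ 0); rewrite ?mulr_ge0_le0 // mulr_ge0 // phi_ge0.
Qed.

(** At y' <= 0 the point x = 1, where [phi] vanishes, does at least as well as any x > 1, so only
    slopes up to 1 count. This and the next lemma serve to clamp the dual variable [m]. *)
Lemma conj_slope_le1 (l y y' : R) : 0 <= l -> y <= y' -> y' <= 0 ->
  (conj l y' <= conj l y + (y' - y)%:E)%E.
Proof.
move=> l0 yy y0; apply: conj_le => x x0; rewrite -leeBlDr // -EFinB.
have lp := mulr_ge0 l0 (phi_ge0 x0).
have [x1|x1] := leP x 1.
  by apply: le_trans (le_conj l y x0); rewrite lee_fin; nra.
apply: le_trans (conj_ge l y); rewrite lee_fin; nra.
Qed.

(** Symmetrically, at y >= 0 the point x = 1 does at least as well as any smaller [x]. *)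
Lemma conj_slope_ge1 (l y y' : R) : 0 <= l -> 0 <= y -> y <= y' ->
  (conj l y <= conj l y' - (y' - y)%:E)%E.
Proof.
move=> l0 y0 yy; apply: conj_le => x x0; rewrite leeBrDr // -EFinD.
have lp := mulr_ge0 l0 (phi_ge0 x0).
have [x1|x1] := leP x 1.
  by apply: le_trans (conj_ge l y'); rewrite lee_fin; nra.
by apply: le_trans (le_conj l y' x0); rewrite lee_fin; nra.
Qed.

(** The point at which the derivative l (x^(k-1) - 1) / (k - 1) of l phi equals [Y]. *)
Definition max_slope (l Y : R) : R := (1 + (k - 1) * Y / l) `^ (k - 1)^-1.

Lemma max_slope_ge1 (l Y : R) : 0 < l -> 0 <= Y -> 1 <= max_slope l Y.
Proof.
move=> l0 Y0; have km0 : 0 < k - 1 by move: k1; lra.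
rewrite -[leLHS](powRr0 (1 + (k - 1) * Y / l)); apply: ler_powR.
  by rewrite lerDl divr_ge0 ?mulr_ge0 // ltW.
by rewrite invr_ge0 ltW.
Qed.

(* The maximizer of [x * y - l * phi x] is at most [max_slope l0 Y]. *)
Lemma conj_lipschitz (l0 l Y y y' : R) : 0 < l0 -> l0 <= l -> 0 <= Y ->
  y <= y' -> y' <= Y ->
  (conj l y' <= conj l y + (max_slope l0 Y * (y' - y))%:E)%E.
Proof.
move=> l00 ll Y0 yy yY; have km0 : 0 < k - 1 by move: k1; lra.
have a1 := max_slope_ge1 l00 Y0; set a := max_slope l0 Y in a1 *.
have a0 : 0 < a by lra.
have aE : (a `^ (k - 1) - 1) / (k - 1) = Y / l0.
  rewrite /a /max_slope -powRrM mulVf ?gt_eqF // powRr1.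
    by field; rewrite !gt_eqF.
  by rewrite addr_ge0 // divr_ge0 ?mulr_ge0 // ltW.
have small x : 0 <= x -> x <= a ->
    ((x * y' - l * phi x)%:E <= conj l y + (a * (y' - y))%:E)%E.
  move=> x0 xa; rewrite -leeBlDr // -EFinB.
  by apply: le_trans (le_conj l y x0); rewrite lee_fin; nra.
apply: conj_le => x x0; have [|ax] := leP x a; first exact: small.
apply: le_trans (small a (ltW a0) (lexx _)); rewrite lee_fin.
have := phi_tangent a0 x0; rewrite aE => H.
suff : (x - a) * y' <= l * (phi x - phi a) by lra.
apply: (@le_trans _ _ ((x - a) * Y)); first by rewrite ler_wpM2l // subr_ge0 ltW.
have -> : (x - a) * Y = l0 * (Y / l0 * (x - a)) by field; rewrite gt_eqF.
apply: (@le_trans _ _ (l0 * (phi x - phi a))); first by rewrite ler_wpM2l // ltW.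
rewrite ler_wpM2r //; apply: le_trans H.
by rewrite mulr_ge0 ?divr_ge0 ?subr_ge0 // ltW.
Qed.

(** Positivity of [l] matters: at l = 0 the conjugate is infinite for y > 0, so the grid for [l]
    starts above 0. *)
Lemma conj_fin (l y : R) : 0 < l -> conj l y \is a fin_num.
Proof.
move=> l0; rewrite fin_numElt; apply/andP; split.
  by apply: lt_le_trans (conj_ge l y); rewrite ltNyr.
have [y0|y0] := leP y 0; first by apply: le_lt_trans (conj_le0 (ltW l0) y0) _; rewrite ltry.
apply: le_lt_trans (conj_lipschitz l0 (lexx l) (ltW y0) (ltW y0) (lexx y)) _.
rewrite lte_add_pinfty ?ltry //.
by apply: le_lt_trans (conj_le0 (ltW l0) (lexx 0)) _; rewrite ltry.
Qed.

End CressieRead.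

(** * Discretization of the dual problem *)

Section Risk.
Variables (R : realType) (T : nat) (M : mdp R T) (k tau eps : R).
Hypotheses (k1 : 1 < k) (tau0 : 0 < tau) (eps0 : 0 < eps).

Local Notation conj l := (conjugate (scale_fun l (cressie_read k))).
Local Notation zmax := (T%:R + 1 : R).

Definition total_cost t (h : hist M t) (a : action M t) : R :=
  cum_cost h + cost (cur h) a.

Lemma cum_cost_itv t (h : hist M t) : (t <= T)%N -> 0 <= cum_cost h <= t%:R.
Proof.
elim: t h => [|t IH] h tT /=; first by rewrite lexx.
have /andP[c0 c1] := IH h.1.1 (ltnW tT).
have /andP[d0 d1] := cost_itv (cur h.1.1) h.1.2 (ltnW tT).
by rewrite addr_ge0 //= -natr1 lerD.
Qed.

Lemma total_cost_itv t (h : hist M t) (a : action M t) : (t <= T)%N ->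
  0 <= total_cost h a <= zmax.
Proof.
move=> tT; have /andP[c0 c1] := cum_cost_itv h tT.
have /andP[d0 d1] := cost_itv (cur h) a tT.
rewrite addr_ge0 //= lerD // (le_trans c1) // ler_nat //.
Qed.

Lemma expect_total_costE (Q : trans_kernel M) pi s (f : R -> R) :
  expect_total_cost Q pi s (EFin \o f) =
  (expect Q pi s (fun w => f (total_cost w.1 w.2)))%:E.
Proof. by rewrite /expect_total_cost /expect -sumEFin; apply: eq_bigr. Qed.

Lemma le_expect_total_cost (Q : trans_kernel M) pi s (f g : R -> \bar R) :
  is_kernel Q -> is_policy pi ->
  (forall z, 0 <= z <= zmax -> (f z <= g z)%E) ->
  (expect_total_cost Q pi s f <= expect_total_cost Q pi s g)%E.
Proof.
move=> kQ ppi fg; apply: lee_sum => w _; rewrite lee_wpmul2l //.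
  by rewrite lee_fin path_prob_ge0.
by apply: fg; apply: total_cost_itv.
Qed.

Definition objective (l m z : R) : \bar R :=
  ((l * tau + m)%:E + conj l (z - m)%R)%E.

Definition objective_real (l m z : R) : R :=
  l * tau + m + fine (conj l (z - m)).

Lemma objective_realE l m z : 0 < l -> (objective_real l m z)%:E = objective l m z.
Proof. by move=> l0; rewrite /objective_real EFinD fineK // conj_fin. Qed.

(** Steps of eps / 8 in [m] and in l tau must cover [0, T + 1], the range of a sum of T + 1 costs.
    The two extra points pay for rounding up and for the strict bound of ordinals. *)
Definition grid_size : nat := (Num.truncn (8 * zmax / eps)).+2.
Definition grid_lambda (i : 'I_grid_size) : R := i.+1%:R * (eps / (8 * tau)).
Definition grid_mu (j : 'I_grid_size) : R := j%:R * (eps / 8).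

Lemma zmax_ge0 : 0 <= zmax. Proof. by rewrite addr_ge0. Qed.

Lemma lambda0_gt0 : 0 < eps / (8 * tau).
Proof. by rewrite divr_gt0 // mulr_gt0. Qed.

Lemma grid_lambda_ge i : eps / (8 * tau) <= grid_lambda i.
Proof. by rewrite /grid_lambda ler_peMl ?(ltW lambda0_gt0) // ler1n. Qed.

Lemma grid_lambda_gt0 i : 0 < grid_lambda i.
Proof. exact: lt_le_trans lambda0_gt0 (grid_lambda_ge i). Qed.

(** Subtracting the value at 0 removes the term l tau + m, which is not controlled by the slope.
    Since m >= 0, the arguments z - m stay below T + 1, where the Lipschitz bound is available. *)
Lemma objective_real_itv i j z : 0 <= z <= zmax ->
  `|objective_real (grid_lambda i) (grid_mu j) z
    - objective_real (grid_lambda i) (grid_mu j) 0| <=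
  max_slope k (eps / (8 * tau)) zmax * zmax.
Proof.
move=> /andP[z0 zm]; set l := grid_lambda i; set m := grid_mu j.
have l0 : 0 < l := grid_lambda_gt0 i.
have m0 : 0 <= m by rewrite mulr_ge0 ?ler0n // divr_ge0 // ltW.
have zz : 0 - m <= z - m by rewrite lerD2r.
have a1 := max_slope_ge1 k1 lambda0_gt0 zmax_ge0.
set a := max_slope _ _ _ in a1 *.
have up : (conj l (z - m) <= conj l (0 - m) + (a * z)%:E)%E.
  have := conj_lipschitz k1 lambda0_gt0 (grid_lambda_ge i) zmax_ge0 zz.
  by rewrite opprB addrA subrK subr0; apply; lra.
have lo := conj_monotone k l zz.
have fz := conj_fin k1 (z - m) l0; have f0 := conj_fin k1 (0 - m) l0.
rewrite /objective_real; move: up lo; rewrite -(fineK fz) -(fineK f0) -EFinD !lee_fin /=.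
move: (fine _) (fine _) => c d up lo.
have az : a * z <= a * zmax by rewrite ler_wpM2l //; lra.
have az0 : 0 <= a * z by rewrite mulr_ge0 //; lra.
by rewrite ler_norml; lra.
Qed.

(** Above T + 1 the linear term [m] grows faster than the conjugate decreases; below 0 the conjugate
    gains more than [m] loses. *)
Lemma objective_clamp l m z : 0 <= l -> 0 <= z <= zmax ->
  (objective l (Num.max 0 (Num.min m zmax))%R z <= objective l m z)%E.
Proof.
move=> l0 /andP[z0 zm]; have Z0 := zmax_ge0; rewrite /objective.
have [mz|mz] := leP m zmax.
  have [m0|m0] := leP 0 m => //; rewrite subr0.
  have := @conj_slope_ge1 _ k k1 l z (z - m) l0 z0.
  have -> : z - m - z = - m by ring.
  rewrite lerDl oppr_ge0 => /(_ (ltW m0)).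
  case: (conj l z) (conj l (z - m)) => [c| |] [d| |] //=; rewrite ?lee_fin ?leey ?leNye //.
  by lra.
rewrite (max_idPr Z0).
have := @conj_slope_le1 _ k k1 l (z - m) (z - zmax) l0.
have -> : z - zmax - (z - m) = m - zmax by ring.
rewrite lerD2l lerN2 subr_le0 => /(_ (ltW mz) zm).
case: (conj l (z - zmax)) (conj l (z - m)) => [c| |] [d| |] //=; rewrite ?lee_fin ?leey ?leNye //.
by lra.
Qed.

Lemma grid_approx (x c : R) : 0 < c -> 0 <= x ->
  exists2 i, x < i.+1%:R * c <= x + c & forall y, x <= y -> (i <= Num.truncn (y / c))%N.
Proof.
move=> c0 x0; exists (Num.truncn (x / c)) => [|y xy].
  have /truncn_itv/andP[lo up] : 0 <= x / c by rewrite divr_ge0 // ltW.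
  rewrite -ltr_pdivrMr // up /= -natr1 mulrDl mul1r lerD2r.
  by rewrite -ler_pdivlMr.
by apply: le_truncn; rewrite ler_wpM2r // invr_ge0 ltW.
Qed.

(** The grid point does not depend on [z], so the bound survives taking expectations. Rounding [l]
    and [m] up can only lower the conjugate, and costs eps / 8 in each linear term. *)
Lemma objective_grid l m : 0 <= l -> exists i j, forall z, 0 <= z <= zmax ->
  ((objective_real (grid_lambda i) (grid_mu j) z)%:E <=
   objective l m z + (eps / 4)%:E)%E.
Proof.
move=> l0; have Z0 := zmax_ge0; have L0 := lambda0_gt0.
have e8 : 0 < eps / 8 by rewrite divr_gt0.
have tauE : eps / (8 * tau) * tau = eps / 8 by field; rewrite gt_eqF.
have approx_mu x : 0 <= x -> x <= zmax ->
    exists j : 'I_grid_size, x <= grid_mu j <= x + eps / 8.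
  move=> x0 xz; have [j /andP[lo up] /(_ _ xz) jN] := grid_approx e8 x0.
  have jlt : (j.+1 < grid_size)%N.
    rewrite /grid_size ltnS ltnS; apply: leq_trans jN _.
    by have -> : zmax / (eps / 8) = 8 * zmax / eps by field; rewrite gt_eqF.
  by exists (Ordinal jlt); rewrite /grid_mu /= (ltW lo) up.
(* For large [l] the objective is at least l tau + z, hence at least T + 1; the smallest grid [l],
   with [m] just above T + 1, already achieves T + 1 + eps / 4. *)
have [lbig|lsmall] := leP zmax (l * tau).
  have [j /andP[lo up]] := approx_mu _ Z0 (lexx _).
  exists ord0, j => z /andP[z0 zm]; rewrite objective_realE ?grid_lambda_gt0 //.
  apply: (@le_trans _ _ (zmax + eps / 4)%:E); last first.
    rewrite EFinD leeD2r // /objective.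
    apply: (@le_trans _ _ ((l * tau + m)%:E + (z - m)%:E)%E).
      by rewrite -EFinD lee_fin; lra.
    by rewrite leeD2l // conj_ge.
  rewrite /objective.
  apply: (@le_trans _ _ ((grid_lambda ord0 * tau + grid_mu j)%:E + 0)%E).
    by rewrite leeD2l // conj_le0 ?(ltW (grid_lambda_gt0 _)) //; lra.
  rewrite adde0 lee_fin {1}/grid_lambda mul1r tauE; lra.
set m' := Num.max 0 (Num.min m zmax).
have m'0 : 0 <= m' by rewrite le_max lexx.
have m'z : m' <= zmax by rewrite ge_max Z0 ge_min lexx orbT.
have [j /andP[jlo jup]] := approx_mu _ m'0 m'z.
have [i /andP[ilo iup] iN] := grid_approx L0 l0.
have ilt : (i < grid_size)%N.
  apply: (@leq_ltn_trans (Num.truncn (8 * zmax / eps))); last by rewrite /grid_size.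
  have -> : 8 * zmax / eps = (zmax / tau) / (eps / (8 * tau)).
    by field; rewrite !gt_eqF.
  by apply: iN; rewrite ler_pdivlMr // ltW.
exists (Ordinal ilt), j => z zz; rewrite objective_realE ?grid_lambda_gt0 //.
have := objective_clamp m l0 zz; rewrite -/m' => cl.
apply: (@le_trans _ _ (objective l m' z + (eps / 4)%:E)%E); last by rewrite leeD2r.
rewrite /objective /grid_lambda /= addeAC -EFinD.
apply: leeD; last first.
  apply: le_trans (conj_antitone k1 _ (ltW ilo)); apply: conj_monotone.
  by rewrite lerD2l lerN2.
rewrite lee_fin.
have : i.+1%:R * (eps / (8 * tau)) * tau <= l * tau + eps / 8.
  by rewrite -tauE -mulrDl ler_wpM2r // ltW.
lra.
Qed.

Section KernelPolicy.
Variables (Q : trans_kernel M) (pi : policy M) (s : state M 0).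
Hypotheses (kQ : is_kernel Q) (ppi : is_policy pi).

Definition grid_expect i j : R := expect Q pi s (fun w =>
  objective_real (grid_lambda i) (grid_mu j) (total_cost w.1 w.2)).

Lemma expect_objective_real l m : 0 < l ->
  ((expect Q pi s (fun w => objective_real l m (total_cost w.1 w.2)))%:E =
  (l * tau + m)%:E + expect_total_cost Q pi s (fun z => conj l (z - m)%R))%E.
Proof.
move=> l0; rewrite /objective_real.
have -> : expect Q pi s (fun w => l * tau + m + fine (conj l (total_cost w.1 w.2 - m))) =
   l * tau + m + expect Q pi s (fun w => fine (conj l (total_cost w.1 w.2 - m))).
  rewrite -{2}(expect_cst s kQ ppi (l * tau + m)) -[X in _ = _ + X]mul1r -expect_affine.
  by apply: eq_bigr => w _; rewrite mul1r.
rewrite EFinD; congr (_ + _)%E.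
rewrite -(expect_total_costE _ _ _ (fun z => fine (conj l (z - m)))).
by apply: eq_bigr => w _ /=; rewrite fineK // conj_fin.
Qed.

Lemma dr_risk_le i j : (dr_risk k tau Q pi s <= (grid_expect i j)%:E)%E.
Proof.
rewrite /grid_expect expect_objective_real ?grid_lambda_gt0 //.
apply: ereal_inf_lbound; exists (grid_lambda i, grid_mu j) => //=.
exact: ltW (grid_lambda_gt0 i).
Qed.

(** The objective may be infinite when l = 0, so lower bounds go through a real-valued minorant,
    whose expectation is real. *)
Lemma dr_risk_lower (b : R) :
  (forall l m, 0 <= l -> exists2 f : R -> R,
    b <= expect Q pi s (fun w => f (total_cost w.1 w.2)) &
    forall z, 0 <= z <= zmax -> ((f z)%:E <= objective l m z)%E) ->
  (b%:E <= dr_risk k tau Q pi s)%E.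
Proof.
move=> H; apply: le_ereal_inf_tmp => _ [[l m] /= l0 <-].
have [f bf fo] := H l m l0.
have : (expect_total_cost Q pi s (EFin \o (fun z => - (l * tau + m) + 1 * f z)%R) <=
    expect_total_cost Q pi s (fun z => conj l (z - m)%R))%E.
  apply: le_expect_total_cost => // z zz /=; have := fo z zz; rewrite /objective.
  case: (conj l (z - m)) => [c| |] //=; rewrite ?leey //.
  by rewrite -EFinD !lee_fin; lra.
rewrite expect_total_costE expect_affine expect_cst // mul1r.
apply: (le_trans _ \o @leeD2l _ (l * tau + m)%:E _ _).
by rewrite -EFinD lee_fin; lra.
Qed.

Lemma dr_risk_ge : exists i j, ((grid_expect i j - eps / 4)%:E <= dr_risk k tau Q pi s)%E.
Proof.
pose p0 : 'I_grid_size * 'I_grid_size := (ord0, ord0).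
have [[i j] _ ijmin] := @arg_minP _ _ _ p0 xpredT (fun p => grid_expect p.1 p.2) isT.
exists i, j; apply: dr_risk_lower => l m l0; have [i' [j' H]] := objective_grid m l0.
exists (fun z => - (eps / 4) + 1 * objective_real (grid_lambda i') (grid_mu j') z).
  rewrite expect_affine expect_cst // mul1r addrC lerD2l.
  exact: (ijmin (i', j') isT).
move=> z zz; rewrite mul1r EFinD addeC -[leRHS](addeK _ (isT : (eps / 4)%:E \is a fin_num)).
by rewrite leeD2r // H.
Qed.

Lemma dr_risk_ge0 : (0 <= dr_risk k tau Q pi s)%E.
Proof.
apply: dr_risk_lower => l m l0; exists id => [|z /andP[z0 _]].
  rewrite -(expect_cst s kQ ppi 0); apply: le_expect => // w.
  by have /andP[] := total_cost_itv w.1 w.2 (leqnn T).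
rewrite /objective.
apply: (@le_trans _ _ ((l * tau + m)%:E + (z - m)%:E)%E); last by rewrite leeD2l // conj_ge.
rewrite -EFinD lee_fin.
by have := mulr_ge0 l0 (ltW tau0); lra.
Qed.

Lemma dr_risk_le_zmax : (dr_risk k tau Q pi s <= zmax%:E)%E.
Proof.
(* Dual point l = 0, m = T + 1: the conjugate is only evaluated at nonpositive arguments. *)
apply: (@le_trans _ _ ((0 * tau + zmax)%:E +
    expect_total_cost Q pi s (fun z => conj 0 (z - zmax)%R))%E).
  by apply: ereal_inf_lbound; exists (0, zmax) => //=.
rewrite mul0r add0r -[leRHS]adde0 leeD2l //.
have E0 : expect_total_cost Q pi s (EFin \o (fun=> 0)) = 0%E.
  by rewrite (expect_total_costE Q pi s (fun=> 0)) expect_cst.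
rewrite -[leRHS]E0.
apply: le_expect_total_cost => // z /andP[_ zm] /=.
by rewrite conj_le0 // subr_le0.
Qed.

End KernelPolicy.
End Risk.

(** * Deviation of the risks *)

Lemma abse_sub_le (R : realType) (x y : \bar R) (e : R) :
  x \is a fin_num -> y \is a fin_num -> (x <= y + e%:E)%E -> (y <= x + e%:E)%E ->
  (`|x - y| <= e%:E)%E.
Proof.
case: x y => [x| |] [y| |] //= _ _; rewrite -!EFinD !lee_fin ler_norml => xy yx.
by apply/andP; split; lra.
Qed.

Section OptimalRisk.
Variables (R : realType) (T : nat) (M : mdp R T) (k tau : R).
Hypotheses (k1 : 1 < k) (tau0 : 0 < tau).
Local Notation zmax := (T%:R + 1 : R).

Lemma itv_fin_num (x : \bar R) : (0 <= x)%E -> (x <= zmax%:E)%E -> x \is a fin_num.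
Proof. by case: x => [x| |]. Qed.

Lemma opt_dr_risk_ge0 (Q : trans_kernel M) s : is_kernel Q ->
  (0 <= opt_dr_risk k tau Q s)%E.
Proof.
by move=> kQ; apply: le_ereal_inf_tmp => _ [pi /= ppi <-]; exact: dr_risk_ge0.
Qed.

Lemma opt_dr_risk_le (Q : trans_kernel M) pi s : is_policy pi ->
  (opt_dr_risk k tau Q s <= dr_risk k tau Q pi s)%E.
Proof. by move=> ppi; apply: ereal_inf_lbound; exists pi. Qed.

Lemma opt_dr_risk_le_zmax (Q : trans_kernel M) s : is_kernel Q ->
  (opt_dr_risk k tau Q s <= zmax%:E)%E.
Proof.
move=> kQ; have ppi := greedy_policy (fun t (h : hist M t) (a : action M t) => 0).
by apply: le_trans (opt_dr_risk_le Q s ppi) _; exact: dr_risk_le_zmax.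
Qed.

Variable eps : R.
Hypothesis eps0 : 0 < eps.
Local Notation gexp := (grid_expect k tau (eps := eps)).

Lemma dr_risk_le_add (Q Q' : trans_kernel M) pi s :
  is_kernel Q -> is_kernel Q' -> is_policy pi ->
  (forall i j, gexp Q pi s i j <= gexp Q' pi s i j + eps / 2) ->
  (dr_risk k tau Q pi s <= dr_risk k tau Q' pi s + eps%:E)%E.
Proof.
move=> kQ kQ' ppi H.
have [i [j ij]] := dr_risk_ge k1 tau0 eps0 s kQ' ppi.
apply: le_trans (leeD2r _ ij); apply: le_trans (dr_risk_le k1 tau0 eps0 s kQ ppi i j) _.
by rewrite -EFinD lee_fin; have := H i j; have := eps0; lra.
Qed.

Lemma dr_risk_dist_le (Q Q' : trans_kernel M) pi s :
  is_kernel Q -> is_kernel Q' -> is_policy pi ->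
  (forall i j, `|gexp Q pi s i j - gexp Q' pi s i j| <= eps / 2) ->
  (`|dr_risk k tau Q pi s - dr_risk k tau Q' pi s| <= eps%:E)%E.
Proof.
move=> kQ kQ' ppi H; apply: abse_sub_le.
- by apply: itv_fin_num; [exact: dr_risk_ge0|exact: dr_risk_le_zmax].
- by apply: itv_fin_num; [exact: dr_risk_ge0|exact: dr_risk_le_zmax].
- apply: dr_risk_le_add => // i j; have := H i j; rewrite ler_norml; lra.
- apply: dr_risk_le_add => // i j; have := H i j; rewrite ler_norml; lra.
Qed.

(** The comparison policy may depend on the grid point: with the dual variables frozen, minimizing
    over policies is a risk-neutral problem, open to dynamic programming. *)
Lemma opt_dr_risk_le_add (Q Q' : trans_kernel M) s :
  is_kernel Q -> is_kernel Q' ->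
  (forall i j pi, is_policy pi -> exists2 pi', is_policy pi' &
     gexp Q pi' s i j <= gexp Q' pi s i j + eps / 2) ->
  (opt_dr_risk k tau Q s <= opt_dr_risk k tau Q' s + eps%:E)%E.
Proof.
move=> kQ kQ' H; rewrite -leeBlDr //; apply: le_ereal_inf_tmp => _ [pi ppi <-].
rewrite leeBlDr //; have [i [j ij]] := dr_risk_ge k1 tau0 eps0 s kQ' ppi.
have [pi' ppi' pp] := H i j pi ppi.
apply: le_trans (leeD2r _ ij); apply: le_trans (opt_dr_risk_le _ _ ppi') _.
apply: le_trans (dr_risk_le k1 tau0 eps0 s kQ ppi' i j) _.
by rewrite -EFinD lee_fin; have := eps0; lra.
Qed.

Lemma opt_dr_risk_dist_le (Q Q' : trans_kernel M) s :
  is_kernel Q -> is_kernel Q' ->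
  (opt_dr_risk k tau Q s <= opt_dr_risk k tau Q' s + eps%:E)%E ->
  (opt_dr_risk k tau Q' s <= opt_dr_risk k tau Q s + eps%:E)%E ->
  (`|opt_dr_risk k tau Q s - opt_dr_risk k tau Q' s| <= eps%:E)%E.
Proof.
by move=> kQ kQ'; apply: abse_sub_le; apply: itv_fin_num;
  rewrite ?opt_dr_risk_ge0 ?opt_dr_risk_le_zmax.
Qed.

Variables (B : R) (n : nat).
Hypotheses (B_ge : max_slope k (eps / (8 * tau)) zmax * zmax <= B) (eps_B : eps <= B).
Hypothesis n0 : (0 < n)%N.
Local Notation P := (@trans R T M).
Local Notation N := (grid_size T eps).
Local Notation tail := (expR (- (n%:R * (eps ^+ 2 / (16 * B ^+ 2))))).
(** The maximizer of r eps / 2 - (r B)^2; the maximum eps^2 / (16 B^2) is the rate in [tail]. *)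
Local Notation r := (eps / (4 * B ^+ 2)).

Let B0 : 0 < B. Proof. exact: lt_le_trans eps_B. Qed.
Let r0 : 0 < r. Proof. by rewrite divr_gt0 // mulr_gt0 // exprn_gt0. Qed.
Let rBE : r * B = eps / (4 * B).
Proof. by field; rewrite gt_eqF. Qed.
Let rB : r * B <= 4^-1.
Proof.
rewrite rBE ler_pdivrMr ?mulr_gt0 // mulrA mulVf ?mul1r //.
Qed.

Let centered (i j : 'I_N) t (h : hist M t) (a : action M t) : R :=
  objective_real k tau (grid_lambda tau i) (grid_mu j) (total_cost h a)
  - objective_real k tau (grid_lambda tau i) (grid_mu j) 0.

Let centered_le i j t (h : hist M t) a : (t <= T)%N -> `|centered i j h a| <= B.
Proof.
move=> tT; apply: le_trans B_ge; apply: objective_real_itv => //.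
exact: total_cost_itv.
Qed.

Let gexpE Q pi s i j : is_kernel Q -> is_policy pi -> gexp Q pi s i j =
  objective_real k tau (grid_lambda tau i) (grid_mu j) 0 +
  expect Q pi s (fun w => centered i j w.1 w.2).
Proof.
move=> kQ ppi; rewrite -[X in _ + X]mul1r -{1}(expect_cst s kQ ppi (objective_real _ _ _ _ _)).
rewrite -expect_affine; apply: eq_bigr => w _; congr (_ * _).
by rewrite mul1r /centered addrC subrK.
Qed.

Let tailE : expR (- (n%:R * (r * (eps / 2) - (r * B) ^+ 2))) = tail.
Proof. by congr (expR (- (_ * _))); rewrite rBE; field; rewrite gt_eqF. Qed.

Let upper_tail pi s i j : is_policy pi ->
  sample_prob (fun om : sample M n =>
    gexp P pi s i j + eps / 2 <= gexp (empirical om) pi s i j) <= tail.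
Proof.
move=> ppi; rewrite -tailE.
have cB (w : hist M T * action M T) : `|centered i j w.1 w.2| <= B by exact: centered_le.
apply: le_trans (sample_prob_expect_ge s (eps / 2) n0 ppi cB (ltW r0) rB).
apply: sample_prob_mono => om; rewrite !gexpE //; first lra.
- exact: empirical_kernel.
- exact: trans_kernelP.
Qed.

Let lower_tail pi s i j : is_policy pi ->
  sample_prob (fun om : sample M n =>
    gexp (empirical om) pi s i j + eps / 2 <= gexp P pi s i j) <= tail.
Proof.
move=> ppi; rewrite -tailE.
(* The upper-tail bound is applied to the negated function, written in the affine form of
   [expect_affine]. *)
have cB (w : hist M T * action M T) : `|0 + -1 * centered i j w.1 w.2| <= B.
  by rewrite add0r mulN1r normrN; exact: centered_le.
apply: le_trans (sample_prob_expect_ge s (eps / 2) n0 ppi cB (ltW r0) rB).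
have kP := @trans_kernelP R T M.
apply: sample_prob_mono => om; have kQ := empirical_kernel om n0.
by rewrite !gexpE // !expect_affine !expect_cst //; lra.
Qed.

Lemma sample_prob_dr_risk pi : is_policy pi ->
  1 - #|state M 0|%:R * (N ^ 2)%:R * (2 * tail) <=
  sample_prob (fun om : sample M n => [forall s : state M 0,
     (`|dr_risk k tau (empirical om) pi s - dr_risk k tau P pi s| <= eps%:E)%E]).
Proof.
move=> ppi; have kP := @trans_kernelP R T M.
pose bad (om : sample M n) (p : state M 0 * ('I_N * 'I_N)) :=
  (gexp P pi p.1 p.2.1 p.2.2 + eps / 2 <= gexp (empirical om) pi p.1 p.2.1 p.2.2) ||
  (gexp (empirical om) pi p.1 p.2.1 p.2.2 + eps / 2 <= gexp P pi p.1 p.2.1 p.2.2).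
apply: (@sample_prob_ge _ _ _ _ _ (fun om => [exists p, bad om p])).
  apply: le_trans (sample_prob_exists _) _.
  apply: (@le_trans _ _ (\sum_(p : state M 0 * ('I_N * 'I_N)) 2 * tail)).
    apply: ler_sum => p _; apply: le_trans (sample_probU _ _) _.
    by rewrite mulr_natl mulr2n lerD ?upper_tail ?lower_tail.
  by rewrite sumr_const !card_prod card_ord -[leLHS]mulr_natl natrM mulnn.
move=> om; rewrite negb_exists => /forallP good; apply/forallP => s.
have kQ := empirical_kernel om n0.
apply: dr_risk_dist_le => // i j; have := good (s, (i, j)).
by rewrite negb_or -!ltNge /= ler_norml; lra.
Qed.

(** The greedy policy of the true model is independent of the samples, so the fixed-policy tail
    bounds the empirical optimum from above; this is the term 1. The converse must hold for all
    policies and comes from [cum_dev], which gives the number of histories. *)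
Lemma sample_prob_opt_dr_risk :
  1 - #|state M 0|%:R * (N ^ 2)%:R * ((1 + #|hist M T|%:R) * tail) <=
  sample_prob (fun om : sample M n => [forall s : state M 0,
     (`|opt_dr_risk k tau (empirical om) s - opt_dr_risk k tau P s| <= eps%:E)%E]).
Proof.
have kP := @trans_kernelP R T M.
pose pi i j := greedy (centered i j).
have ppi i j : is_policy (pi i j) by exact: greedy_policy.
pose c := eps ^+ 2 / (16 * B ^+ 2).
pose bad (om : sample M n) (p : state M 0 * ('I_N * 'I_N)) :=
  (gexp P (pi p.2.1 p.2.2) p.1 p.2.1 p.2.2 + eps / 2 <=
     gexp (empirical om) (pi p.2.1 p.2.2) p.1 p.2.1 p.2.2) ||
  [exists h : hist M T, c < cum_dev (centered p.2.1 p.2.2) r om h].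
apply: (@sample_prob_ge _ _ _ _ _ (fun om => [exists p, bad om p])).
  apply: le_trans (sample_prob_exists _) _.
  apply: (@le_trans _ _ (\sum_(p : state M 0 * ('I_N * 'I_N)) (1 + #|hist M T|%:R) * tail)).
    apply: ler_sum => p _; apply: le_trans (sample_probU _ _) _.
    rewrite [leRHS](_ : _ = tail + #|hist M T|%:R * tail); last by rewrite mulrDl mul1r.
    apply: lerD; first exact: upper_tail.
    exact: (sample_prob_cum_dev (@centered_le p.2.1 p.2.2) (ltW r0) rB n0 c).
  by rewrite sumr_const !card_prod card_ord -[leLHS]mulr_natl natrM mulnn.
move=> om; rewrite negb_exists => /forallP good; apply/forallP => s.
have kQ := empirical_kernel om n0.
apply: opt_dr_risk_dist_le => //; apply: opt_dr_risk_le_add => // i j pi' ppi'.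
  exists (pi i j) => //; have := good (s, (i, j)); rewrite negb_or -ltNge /= => /andP[lt _].
  apply: le_trans (ltW lt) _; rewrite !gexpE // lerD2r lerD2l.
  by rewrite expect_greedy value_le_expect.
exists (pi i j) => //; rewrite !gexpE // -[leRHS]addrA lerD2l expect_greedy.
have := good (s, (i, j)); rewrite negb_or negb_exists => /andP[_ /forallP dev].
have dev' (h : hist M T) : cum_dev (centered i j) r om h <= c by rewrite leNgt; exact: dev.
have := value_le_expect_empirical (@centered_le i j) (ltW r0) rB n0 s ppi' dev'.
(* Both (r B)^2 and c equal eps^2 / (16 B^2), half of r eps / 2. *)
rewrite -[leRHS]addrA (_ : (r * B) ^+ 2 + c = r * (eps / 2)); last first.
  by rewrite rBE /c; field; rewrite gt_eqF.
by rewrite -mulrDr ler_pM2l.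
Qed.

End OptimalRisk.

(** * Constants *)

Lemma card_hist (R : realType) (T : nat) (M : mdp R T) t : (t <= T)%N ->
  (#|hist M t| <= (max_states M * max_actions M) ^ t * max_states M)%N.
Proof.
have st t' : (t' <= T)%N -> (#|state M t'| <= max_states M)%N.
  by rewrite -ltnS => tT; exact: (leq_bigmax (Ordinal tT)).
elim: t => [|t IH] tT; first by rewrite expn0 mul1n; exact: st.
have at' : (#|action M t| <= max_actions M)%N.
  have tT' : (t < T.+1)%N by exact: ltnW.
  exact: (@leq_bigmax _ (fun i : 'I_T.+1 => #|action M i|) (Ordinal tT')).
rewrite /= !card_prod expnS.
apply: leq_trans (leq_mul (leq_mul (IH (ltnW tT)) at') (st _ tT)) _.
by rewrite leq_mul2r; apply/orP; right; rewrite -mulnA mulnC.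
Qed.

Section Constants.
Variable R : realType.

(** 800 is 2 * 20^2: 20 bounds the grid size relative to T / eps, and the grid is
    two-dimensional. *)
Lemma expR_ge800 (m : R) : 1 <= m -> 800 <= expR (10 * m).
Proof.
move=> m1; rewrite expRM_natl.
have m2 : 2 <= expR m by have := expR_ge1Dx m; lra.
apply: (@le_trans _ _ (2 ^+ 10)); last by rewrite lerXn2r ?nnegrE ?expR_ge0.
by rewrite -natrX ler_nat.
Qed.

Lemma exprK_powR (a : R) n : 0 <= a -> (0 < n)%N -> (a ^+ n) `^ n%:R^-1 = a.
Proof.
move=> a0 n0; rewrite -powR_mulrn // -powRrM mulfV ?powRr1 //.
by rewrite pnatr_eq0 -lt0n.
Qed.

Definition slope_cst : R := 4 ^+ 16.

Lemma slope_cst_ge1 : 1 <= slope_cst.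
Proof. by rewrite /slope_cst exprn_ege1 // ler1n. Qed.

(* [16 (k - 1) <= k ^ 2] unless [k - 1 >= 1 / 16], and then
   [slope_cst `^ (k - 1) >= 4]. *)
Lemma max_slope_le (k tau eps : R) (T : nat) : 1 < k -> 0 < tau -> 0 < eps -> (0 < T)%N ->
  max_slope k (eps / (8 * tau)) (T%:R + 1) <=
  slope_cst * (k ^+ 2 * T%:R * tau / eps + k) `^ (1 / (k - 1)).
Proof.
move=> k1 tau0 eps0 T0; have T1 : 1 <= T%:R :> R by rewrite ler1n.
have km0 : 0 < k - 1 by lra.
have D1 := slope_cst_ge1; have D0 : 0 <= slope_cst by lra.
set u := T%:R * tau / eps.
have u0 : 0 < u by rewrite /u divr_gt0 // mulr_gt0 //; lra.
have -> : k ^+ 2 * T%:R * tau / eps + k = k ^+ 2 * u + k.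
  by rewrite /u; field; rewrite gt_eqF.
have G0 : 0 <= k ^+ 2 * u + k by nra.
have D4 : 1 <= slope_cst `^ (k - 1).
  by rewrite -[leLHS](powRr0 slope_cst) ler_powR // ltW.
rewrite /max_slope div1r.
have DE : slope_cst = (slope_cst `^ (k - 1)) `^ (k - 1)^-1.
  by rewrite -powRrM mulfV ?gt_eqF // powRr1.
rewrite [in leRHS]DE -powRM ?powR_ge0 //.
apply: ge0_ler_powR; rewrite ?nnegrE ?invr_ge0 ?(ltW km0) //.
- apply: addr_ge0 => //; apply: divr_ge0; first by rewrite mulr_ge0 ?(ltW km0) //; lra.
  by rewrite divr_ge0 ?mulr_ge0 ?(ltW eps0) ?(ltW tau0).
- by rewrite mulr_ge0 ?powR_ge0.
apply: (@le_trans _ _ (1 + 16 * (k - 1) * u)).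
  rewrite lerD2l (_ : _ / _ = 8 * (k - 1) * (T%:R + 1) * (tau / eps)); last first.
    by field; rewrite !gt_eqF.
  have -> : 16 * (k - 1) * u = 8 * (k - 1) * (2 * T%:R) * (tau / eps) by rewrite /u; ring.
  rewrite ler_wpM2r ?divr_ge0 ?(ltW tau0) ?(ltW eps0) //.
  rewrite ler_wpM2l ?mulr_ge0 ?(ltW km0) //; lra.
have [k16|k16] := leP (k - 1) 16^-1.
  apply: (@le_trans _ _ (k ^+ 2 * u + k)); last by rewrite ler_peMl.
  have : 16 * (k - 1) <= k ^+ 2 by nra.
  by move=> H; have := ler_wpM2r (ltW u0) H; lra.
have D4' : 4 <= slope_cst `^ (k - 1).
  rewrite -[leLHS](exprK_powR (n := 16)) //.
  by apply: ler_powR => //; exact: ltW.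
apply: (@le_trans _ _ (4 * (k ^+ 2 * u + k))); last by rewrite ler_wpM2r.
have : 16 * (k - 1) <= 4 * k ^+ 2 by have := sqr_ge0 (k - 2); nra.
by move=> H; have := ler_wpM2r (ltW u0) H; lra.
Qed.

Lemma grid_size_le (T : nat) (eps : R) : 0 < eps -> (0 < T)%N -> eps <= 2 * T%:R ->
  (grid_size T eps)%:R <= 20 * (T%:R / eps).
Proof.
move=> e0 T0 eT; have T1 : 1 <= T%:R :> R by rewrite ler1n.
have : (Num.truncn (8 * (T%:R + 1) / eps))%:R <= 8 * (T%:R + 1) / eps.
  by rewrite truncn_le divr_ge0 ?(ltW e0) //; lra.
rewrite /grid_size -!natr1 => H.
(* The two extra grid points are absorbed thanks to eps <= 2 T. *)
have e1 : 1 <= 2 * (T%:R / eps) by rewrite mulrA ler_pdivlMr // mul1r.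
have : 8 * (T%:R + 1) / eps <= 16 * (T%:R / eps).
  by rewrite mulrA ler_wpM2r ?invr_ge0 ?(ltW e0) //; lra.
lra.
Qed.

(** The exponent 14 m splits as 10 m for the constant 800, 2 m for the square of S q / delta, and a
    spare 2 m. *)
Lemma union_bound_le (S : nat) (q delta m : R) : 0 <= q -> 0 < delta < 1 -> 1 <= m ->
  S%:R * q / delta <= expR m ->
  S%:R * (20 * q) ^+ 2 * (2 * expR (- (14 * m))) <= delta.
Proof.
move=> q0 /andP[d0 d1] m1; case: S => [|S] Y; first by rewrite !mul0r ltW.
set s : R := S.+1%:R; have s1 : 1 <= s by rewrite /s ler1n.
have [c [c0 cE E8]] : exists c : R, [/\ 0 <= c, c = 800 & c <= expR (10 * m)].
  by exists 800; split; [exact: ler0n| |exact: expR_ge800].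
have Y2 : (s * q / delta) ^+ 2 <= expR (2 * m).
  rewrite expRM_natl lerXn2r ?nnegrE ?expR_ge0 //.
  by apply: divr_ge0; rewrite ?(ltW d0) // mulr_ge0 //; lra.
have sq : s * q ^+ 2 <= delta * (s * q / delta) ^+ 2.
  have -> : delta * (s * q / delta) ^+ 2 = (s * q ^+ 2) * (s / delta).
    by field; rewrite gt_eqF.
  rewrite ler_peMr ?mulr_ge0 ?sqr_ge0 //.
  by rewrite ler_pdivlMr //; lra.
have -> : s * (20 * q) ^+ 2 * (2 * expR (- (14 * m))) =
   (c * (s * q ^+ 2)) / expR (14 * m) by rewrite expRN cE; ring.
rewrite ler_pdivrMr ?expR_gt0 //.
have -> : 14 * m = 10 * m + (2 * m + 2 * m) by ring.
have m2 : 1 <= expR (2 * m) by rewrite -[leLHS]expR0 ler_expR; lra.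
rewrite !expRD; apply: (@le_trans _ _ (expR (10 * m) * (delta * expR (2 * m)))).
  apply: ler_pM => //; first by rewrite mulr_ge0 ?sqr_ge0.
  by apply: le_trans sq _; rewrite ler_wpM2l // ltW.
rewrite mulrCA ler_wpM2l ?(ltW d0) // ler_wpM2l ?expR_ge0 //.
by rewrite ler_peMr ?expR_ge0.
Qed.

(** [Z] stands for the number of state-action pairs. From q >= 1/2 and expR m >= 2 one gets Z <=
    expR (2 m), so Z^T takes 2 T m of the exponent; the constant and the grid take 12 m, and 12 m +
    2 T m <= 14 T m. *)
Lemma path_union_bound_le (S Z T : nat) (q delta m h : R) :
  (0 < S)%N -> (S <= Z)%N -> (0 < T)%N ->
  1 <= 2 * q -> 0 < delta < 1 -> 1 <= m -> Z%:R * q / delta <= expR m ->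
  h <= Z%:R ^+ T * S%:R ->
  S%:R * (20 * q) ^+ 2 * ((1 + h) * expR (- (14 * (T%:R * m)))) <= delta.
Proof.
move=> S0 SZ T0 q1 /andP[d0 d1] m1.
have s1 : 1 <= S%:R :> R by rewrite ler1n.
have sz : S%:R <= Z%:R :> R by rewrite ler_nat.
have t1 : 1 <= T%:R :> R by rewrite ler1n.
move: (S%:R : R) (Z%:R : R) s1 sz => s z s1 sz zq hz.
have q0 : 0 < q by lra.
have [c [c0 cE E8]] : exists c : R, [/\ 0 <= c, c = 800 & c <= expR (10 * m)].
  by exists 800; split; [exact: ler0n| |exact: expR_ge800].
have em0 := expR_gt0 m.
have z2 : z <= expR (2 * m).
  have m2 : 2 <= expR m by have := expR_ge1Dx m; lra.
  have : z * q <= delta * expR m by rewrite [leRHS]mulrC -ler_pdivrMr.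
  rewrite (_ : 2 * m = m + m) ?expRD; last by ring.
  move: (expR m) m2 em0 {zq E8} => x x2 x0 zq; nra.
have zT : z ^+ T <= expR (2 * (T%:R * m)).
  rewrite mulrCA expRM_natl lerXn2r ?nnegrE ?expR_ge0 //; lra.
have zT1 : 1 <= z ^+ T by rewrite exprn_ege1 //; lra.
have Y2 : s ^+ 2 * q ^+ 2 <= delta * expR (2 * m).
  have H : (s * q / delta) ^+ 2 <= expR (2 * m).
    rewrite expRM_natl lerXn2r ?nnegrE ?expR_ge0 //.
      by rewrite divr_ge0 ?mulr_ge0 ?(ltW d0) //; lra.
    apply: le_trans zq; rewrite ler_wpM2r ?invr_ge0 ?(ltW d0) //.
    by rewrite ler_wpM2r // ltW.
  apply: (@le_trans _ _ (delta * (s * q / delta) ^+ 2)); last by rewrite ler_wpM2l // ltW.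
  have -> : delta * (s * q / delta) ^+ 2 = s ^+ 2 * q ^+ 2 * delta^-1.
    by field; rewrite gt_eqF.
  by rewrite ler_peMr ?invf_ge1 ?(ltW d1) // mulr_ge0 ?sqr_ge0.
have h1 : 1 + h <= 2 * (z ^+ T * s) by nra.
rewrite expRN mulrA ler_pdivrMr ?expR_gt0 //.
apply: (@le_trans _ _ (s * (20 * q) ^+ 2 * (2 * (z ^+ T * s)))).
  rewrite ler_wpM2l //; apply: mulr_ge0; rewrite ?sqr_ge0 //; lra.
have -> : s * (20 * q) ^+ 2 * (2 * (z ^+ T * s)) =
    c * (s ^+ 2 * q ^+ 2) * z ^+ T by rewrite cE; ring.
apply: (@le_trans _ _ (expR (10 * m) * (delta * expR (2 * m)) * expR (2 * (T%:R * m)))).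
  apply: ler_pM => //.
  - by rewrite mulr_ge0 // mulr_ge0 ?sqr_ge0.
  - by apply: exprn_ge0; lra.
  - by apply: ler_pM => //; rewrite mulr_ge0 ?sqr_ge0.
rewrite mulrCA -mulrA ler_wpM2l ?(ltW d0) // -!expRD ler_expR.
have : m <= T%:R * m by rewrite ler_peMl //; lra.
lra.
Qed.

(** The factor 64 K^2 cancels 16 B^2 with B = 2 T K L. Here a = 1 for a fixed policy and a = T for
    the optimum. *)
Lemma tail_le (B K T eps m L n a : R) : 0 < eps -> 0 < K -> 0 < T -> 0 < L ->
  B = 2 * T * (K * L) ->
  64 * K ^+ 2 * 14 * (T ^+ 2 * a * L ^+ 2 / eps ^+ 2 * m) <= n ->
  expR (- (n * (eps ^+ 2 / (16 * B ^+ 2)))) <= expR (- (14 * (a * m))).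
Proof.
move=> e0 K0 T0 L0 -> H; rewrite ler_expR lerN2.
have c0 : 0 < eps ^+ 2 / (16 * (2 * T * (K * L)) ^+ 2).
  by rewrite divr_gt0 ?exprn_gt0 // mulr_gt0 ?exprn_gt0 // !mulr_gt0.
apply: le_trans (ler_wpM2r (ltW c0) H); rewrite le_eqVlt; apply/orP; left.
by apply/eqP; field; rewrite !gt_eqF.
Qed.

End Constants.

Lemma sample_prob_true (R : realType) (T : nat) (M : mdp R T) n (delta : R)
    (E : pred (sample M n)) : 0 < delta -> (forall om, E om) -> 1 - delta <= sample_prob E.
Proof.
move=> d0 ET; apply: (@sample_prob_ge _ _ _ _ E pred0) => //.
by rewrite sample_probE Esample_cst ltW.
Qed.

(** * Sample complexity *)

Lemma le_expR_max_ln (R : realType) (x : R) : x <= expR (Num.max 1 (ln x)).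
Proof.
have [x0|x0] := leP x 0; first exact: le_trans x0 (expR_ge0 _).
by rewrite -{1}(lnK (x0 : x \is Num.pos)) ler_expR le_max lexx orbT.
Qed.

Section SampleComplexity.
Variables (R : realType) (k tau : R) (T : nat) (M : mdp R T).
Hypotheses (k1 : 1 < k) (tau0 : 0 < tau) (T0 : (0 < T)%N).
Variables (eps delta : R) (n : nat).
Hypotheses (eps0 : 0 < eps) (delta01 : 0 < delta < 1).
Local Notation Gamma := (k ^+ 2 * T%:R * tau / eps + k).
Local Notation L := (Gamma `^ (1 / (k - 1))).
Local Notation C := (64 * slope_cst R ^+ 2 * 14).
Local Notation B := (2 * T%:R * (slope_cst R * L)).

Let T_ge1 : 1 <= T%:R :> R. Proof. by rewrite ler1n. Qed.

Let Gamma_gt1 : 1 < Gamma.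
Proof.
have : 0 <= k ^+ 2 * T%:R * tau / eps.
  by rewrite divr_ge0 ?(ltW eps0) // mulr_ge0 ?(ltW tau0) // mulr_ge0 // sqr_ge0.
by move: k1; lra.
Qed.

Let L_ge1 : 1 <= L.
Proof.
rewrite -[leLHS](powRr0 Gamma); apply: ler_powR; first exact: ltW.
by rewrite divr_ge0 // subr_ge0 ltW.
Qed.

Let slope_gt0 : 0 < slope_cst R. Proof. exact: lt_le_trans (slope_cst_ge1 R). Qed.
Let L_gt0 : 0 < L. Proof. exact: lt_le_trans L_ge1. Qed.

(** Without draws the empirical kernel vanishes and is no distribution, so n > 0 has to be extracted
    from the sample size condition. *)
Let n_gt0 a m : 0 < a -> 1 <= m ->
  C * (T%:R ^+ 2 * a * L ^+ 2 / eps ^+ 2 * m) <= n%:R -> (0 < n)%N.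
Proof.
move=> a0 m1; have m0 : 0 < m by lra.
have t0 : 0 < T%:R :> R by rewrite ltr0n.
rewrite -(ltr0n R); apply: lt_le_trans.
rewrite mulr_gt0 // ?mulr_gt0 ?exprn_gt0 //.
by rewrite invr_gt0 exprn_gt0.
Qed.

Let B_ge : max_slope k (eps / (8 * tau)) (T%:R + 1) * (T%:R + 1) <= B.
Proof.
have := max_slope_le k1 tau0 eps0 T0 => ms.
rewrite mulrC; apply: ler_pM => //; first exact: powR_ge0.
by move: T_ge1; lra.
Qed.

Let eps_le_B : eps <= 2 * T%:R -> eps <= B.
Proof.
move=> eT; apply: le_trans eT _; rewrite ler_peMr ?mulr_ge0 //.
by rewrite mulr_ege1 // slope_cst_ge1.
Qed.

Let card_state0 : (#|state M 0| <= max_states M)%N.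
Proof. exact: (@leq_bigmax _ (fun i : 'I_T.+1 => #|state M i|) ord0). Qed.

Let grid_sqr_le : eps <= 2 * T%:R ->
  (grid_size T eps ^ 2)%:R <= (20 * (T%:R / eps)) ^+ 2.
Proof.
by move=> eT; rewrite natrX lerXn2r ?nnegrE ?grid_size_le // mulr_ge0 // divr_ge0 // ltW.
Qed.

(** For eps > 2 T >= T + 1 the claim is trivial, since both risks lie in [0, T + 1]; this leaves the
    regime in which the grid size is O(T / eps). *)
Let large_eps (x y : \bar R) : 2 * T%:R < eps ->
  (0 <= x)%E -> (x <= (T%:R + 1)%:E)%E -> (0 <= y)%E -> (y <= (T%:R + 1)%:E)%E ->
  (`|x - y| <= eps%:E)%E.
Proof.
move=> eT; case: x => [x| |] //; case: y => [y| |] //=.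
rewrite !lee_fin ler_norml => x0 x1 y0 y1.
by move: T_ge1 => T1; apply/andP; split; lra.
Qed.

Lemma dr_risk_sample_complexity (pi : policy M) (x : R) :
  is_policy pi -> (#|state M 0|)%:R * (T%:R / eps) / delta <= x ->
  C * (T%:R ^+ 2 * L ^+ 2 / eps ^+ 2 * Num.max 1 (ln x)) <= n%:R ->
  1 - delta <= sample_prob (fun om : sample M n => [forall s : state M 0,
     (`|dr_risk k tau (empirical om) pi s - dr_risk k tau (@trans R T M) pi s|
        <= eps%:E)%E]).
Proof.
move=> ppi Sx; rewrite -[T%:R ^+ 2]mulr1 => Hn; have kP := @trans_kernelP R T M.
have m1 : 1 <= Num.max 1 (ln x) by rewrite le_max lexx.
have n0 := n_gt0 ltr01 m1 Hn; have /andP[d0 d1] := delta01.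
have [eT|eT] := leP eps (2 * T%:R); last first.
  apply: sample_prob_true => // om; apply/forallP => s.
  have kQ := empirical_kernel om n0.
  by apply: large_eps; rewrite ?dr_risk_ge0 ?dr_risk_le_zmax.
apply: le_trans (sample_prob_dr_risk k1 tau0 eps0 B_ge (eps_le_B eT) n0 ppi).
rewrite lerD2l lerN2.
have t0 : 0 < T%:R :> R by rewrite ltr0n.
have tl := tail_le eps0 slope_gt0 t0 L_gt0 erefl Hn.
have q0 : 0 <= T%:R / eps by rewrite divr_ge0 // ltW.
apply: le_trans (union_bound_le q0 delta01 m1 (le_trans Sx (le_expR_max_ln x))).
rewrite ler_pM ?mulr_ge0 ?expR_ge0 //.
  by rewrite ler_wpM2l // grid_sqr_le.
by rewrite [1 * Num.max _ _]mul1r in tl; rewrite ler_wpM2l.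
Qed.

Lemma opt_dr_risk_sample_complexity (x : R) :
  (max_states M)%:R * (max_actions M)%:R * (T%:R / eps) / delta <= x ->
  C * (T%:R ^+ 3 * L ^+ 2 / eps ^+ 2 * Num.max 1 (ln x)) <= n%:R ->
  1 - delta <= sample_prob (fun om : sample M n => [forall s : state M 0,
     (`|opt_dr_risk k tau (empirical om) s - opt_dr_risk k tau (@trans R T M) s|
        <= eps%:E)%E]).
Proof.
move=> Sx; rewrite [T%:R ^+ 3]exprSr => Hn; have kP := @trans_kernelP R T M.
have m1 : 1 <= Num.max 1 (ln x) by rewrite le_max lexx.
have t0 : 0 < T%:R :> R by rewrite ltr0n.
have n0 := n_gt0 t0 m1 Hn; have /andP[d0 d1] := delta01.
have [eT|eT] := leP eps (2 * T%:R); last first.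
  apply: sample_prob_true => // om; apply/forallP => s.
  have kQ := empirical_kernel om n0.
  by apply: large_eps; rewrite ?opt_dr_risk_ge0 ?opt_dr_risk_le_zmax.
apply: le_trans (sample_prob_opt_dr_risk M k1 tau0 eps0 B_ge (eps_le_B eT) n0).
rewrite lerD2l lerN2.
(* With no states at all the failure bound is 0; otherwise the path bound applies. *)
have [S0|S_gt0] := posnP (max_states M).
  move: card_state0; rewrite S0 leqn0 => /eqP ->.
  by rewrite !mul0r ltW.
have tl := tail_le eps0 slope_gt0 t0 L_gt0 erefl Hn.
have q1 : 1 <= 2 * (T%:R / eps) by rewrite mulrA ler_pdivlMr // mul1r.
have A_gt0 : (0 < max_actions M)%N.
  apply: (leq_trans (action_gt0 M (leq0n T))).
  exact: (@leq_bigmax _ (fun i : 'I_T.+1 => #|action M i|) ord0).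
have hle : #|hist M T|%:R <=
    (max_states M * max_actions M)%:R ^+ T * (max_states M)%:R :> R.
  by rewrite -natrX -natrM ler_nat card_hist.
rewrite -natrM in Sx.
apply: le_trans (path_union_bound_le S_gt0 (leq_pmulr _ A_gt0) T0 q1 delta01 m1
  (le_trans Sx (le_expR_max_ln x)) hle).
apply: ler_pM.
- by rewrite mulr_ge0.
- by rewrite mulr_ge0 ?addr_ge0 ?expR_ge0.
- by apply: ler_pM => //; [rewrite ler_nat|exact: grid_sqr_le].
- by rewrite ler_wpM2l ?addr_ge0.
Qed.

(** The union bounds only need S (T / eps) / delta inside the logarithm; the remaining factors [c]
    and [L] are at least 1. *)
Lemma log_argument_ge (S c : R) : 0 <= S -> 1 <= c ->
  S * (T%:R / eps) / delta <= T%:R * S * c * L / (delta * eps).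
Proof.
move=> S0 c1; have /andP[d0 d1] := delta01.
have -> : T%:R * S * c * L / (delta * eps) = S * (T%:R / eps) / delta * (c * L).
  by field; rewrite !gt_eqF.
rewrite ler_peMr; first by [].
  by rewrite divr_ge0 ?(ltW d0) // mulr_ge0 // divr_ge0 // ltW.
by rewrite mulr_ege1.
Qed.

End SampleComplexity.

Lemma policy_of_augP (R : realType) (T : nat) (M : mdp R T) (pi : aug_policy M) :
  is_aug_policy pi -> is_policy (policy_of_aug pi).
Proof. by move=> ppi t h tT; apply: ppi => //; exact: cum_cost_itv. Qed.

Theorem corollary4p3 (R : realType) :
  exists2 C : R, 0 < C &
  forall (k tau : R) (T : nat) (M : mdp R T),
    1 < k -> 0 < tau -> (0 < T)%N ->
    (forall (pi : aug_policy M) (Lpi : R),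
       is_aug_policy pi -> 0 < Lpi -> lipschitz_aug_policy Lpi pi ->
       forall (eps delta : R) (n : nat),
         0 < eps -> 0 < delta < 1 ->
         C * (T%:R ^+ 2
                * (k ^+ 2 * T%:R * tau / eps + k) `^ (2 / (k - 1)) / eps ^+ 2
              * Num.max 1
                  (ln (T%:R * (max_states M)%:R * Num.max 1 (Lpi * tau)
                         * (k ^+ 2 * T%:R * tau / eps + k) `^ (1 / (k - 1))
                       / (delta * eps))))
           <= n%:R ->
         1 - delta <=
         sample_prob (fun om : sample M n =>
           [forall s : state M 0,
              (`|dr_risk k tau (empirical om) (policy_of_aug pi) s
                - dr_risk k tau (@trans R T M) (policy_of_aug pi) s|
              <= eps%:E)%E]))
    /\
    (forall (eps delta : R) (n : nat),
       0 < eps -> 0 < delta < 1 ->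
       C * (T%:R ^+ 3
              * (k ^+ 2 * T%:R * tau / eps + k) `^ (2 / (k - 1)) / eps ^+ 2
            * Num.max 1
                (ln (T%:R * (max_states M)%:R * (max_actions M)%:R
                       * Num.max 1 tau
                       * (k ^+ 2 * T%:R * tau / eps + k) `^ (1 / (k - 1))
                     / (delta * eps))))
         <= n%:R ->
       1 - delta <=
       sample_prob (fun om : sample M n =>
         [forall s : state M 0,
            (`|opt_dr_risk k tau (empirical om) s
              - opt_dr_risk k tau (@trans R T M) s|
            <= eps%:E)%E])).
Proof.
(* 64 slope_cst^2 comes from 16 B^2 in the tail, and 14 from the union bounds. *)
exists (64 * slope_cst R ^+ 2 * 14).
  by rewrite !mulr_gt0 // exprn_gt0 // (lt_le_trans _ (slope_cst_ge1 R)).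
move=> k tau T M k1 tau0 T0.
have sqE (G : R) : G `^ (2 / (k - 1)) = (G `^ (1 / (k - 1))) ^+ 2.
  by rewrite -powR_mulrn ?powR_ge0 // -powRrM; congr (_ `^ _); ring.
split=> [pi Lpi ppi Lpi0 _|] eps delta n eps0 delta01; rewrite sqE.
  apply: dr_risk_sample_complexity => //; first exact: policy_of_augP.
  have c1 : 1 <= Num.max 1 (Lpi * tau) by rewrite le_max lexx.
  have := log_argument_ge T k1 tau0 eps0 delta01 (ler0n R (max_states M)) c1.
  apply: le_trans; have /andP[d0 _] := delta01.
  rewrite !ler_wpM2r ?invr_ge0 ?(ltW d0) ?divr_ge0 ?(ltW eps0) // ler_nat.
  exact: (@leq_bigmax _ (fun i : 'I_T.+1 => #|state M i|) ord0).
apply: opt_dr_risk_sample_complexity => //.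
rewrite -[X in _ <= X * _ * _ / _]mulrA.
by apply: log_argument_ge; rewrite ?mulr_ge0 // le_max lexx.
Qed.
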